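(* Let $A_1,\dots,A_n$ be wqos. Suppose there exist $i\in[1,n]$ such that $\mathbf{o}(A_i)$ is an infinite indecomposable ordinal, and $j_1\ne j_2\in[1,n]$ such that all exponents in the Cantor normal forms of $\mathbf{o}(A_{j_1})$ and $\mathbf{o}(A_{j_2})$ are infinite. Then $\mathbf{w}(A_1\times\dots\times A_n)=\mathbf{o}(A_1)\otimes\dots\otimes\mathbf{o}(A_n)$.
   Context: A wqo is a quasi-order with no infinite bad sequence (a sequence $x_0,x_1,\dots$ is bad if there are no $i<j$ with $x_i\le x_j$). $\mathbf{w}(A)$ (width) is the rank of the forest of nonempty finite sequences of pairwise incomparable elements ordered by initial segment; $\mathbf{o}(A)$ (maximal order type) is the rank of the forest of nonempty finite bad sequences ordered by initial segment (equivalently the maximal order type of a linear extension). An ordinal is infinite indecomposable if it equals $\omega^\beta$ with $\beta\ge1$. Products have the componentwise order; $\otimes$ is the natural (Hessenberg) product. *)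

(* Defs.v *)
From Stdlib Require Import List Permutation.
From mathcomp Require Import all_boot.
Set Implicit Arguments.
Unset Strict Implicit.
Unset Printing Implicit Defensive.

(* osup I f denotes the least ordinal strictly greater than every f i. *)
Inductive Ord : Type := osup : forall (I : Type), (I -> Ord) -> Ord.

Fixpoint ole (x y : Ord) : Prop :=
  match x, y with
  | @osup K f, @osup J g => forall i : K, exists j : J, ole (f i) (g j)
  end.

Definition olt (x y : Ord) : Prop :=
  match y with @osup J g => exists j : J, ole x (g j) end.

Definition oeq (x y : Ord) : Prop := ole x y /\ ole y x.

Definition ozero : Ord := osup (fun e : False => match e with end).
Definition osucc (x : Ord) : Ord := osup (fun _ : unit => x).
Definition oone : Ord := osucc ozero.

Fixpoint ofin (n : nat) : Ord :=
  match n with 0 => ozero | S m => osucc (ofin m) end.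

Definition oomega : Ord := osup ofin.

Fixpoint oadd (x y : Ord) : Ord :=
  match y with
  | @osup J g =>
    let '@osup K f := x in
    osup (fun s : K + J => match s with inl i => f i | inr j => oadd x (g j) end)
  end.

Fixpoint omul (x y : Ord) : Ord :=
  match y with
  | @osup J g =>
    let '@osup K f := x in
    osup (fun p : J * K => oadd (omul x (g p.1)) (f p.2))
  end.

Fixpoint oexpw (y : Ord) : Ord :=
  match y with
  | @osup K f =>
    osup (fun o : option (K * nat) =>
            match o with
            | None => ozero
            | Some p => omul (oexpw (f p.1)) (ofin p.2)
            end)
  end.

Definition osum (l : seq Ord) : Ord := foldr oadd ozero l.

Fixpoint nonincr (l : seq Ord) : Prop :=
  match l with
  | a :: ((b :: _) as l') => ole b a /\ nonincr l'
  | _ => True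
  end.

Definition is_CNF (a : Ord) (bs : seq Ord) : Prop :=
  nonincr bs /\ oeq a (osum (map oexpw bs)).

Definition perm_oeq (l1 l2 : seq Ord) : Prop :=
  exists l, Permutation l1 l /\ Forall2 oeq l l2.

Definition nsum (a b c : Ord) : Prop :=
  exists as_ bs cs, is_CNF a as_ /\ is_CNF b bs /\ is_CNF c cs /\
    perm_oeq (as_ ++ bs) cs.

Definition nprod (a b c : Ord) : Prop :=
  exists as_ bs es cs,
    is_CNF a as_ /\ is_CNF b bs /\
    Forall2 (fun p e => nsum p.1 p.2 e) [seq (x, y) | x <- as_, y <- bs] es /\
    is_CNF c cs /\ perm_oeq es cs.

Fixpoint nprods (l : seq Ord) (c : Ord) : Prop :=
  match l with
  | [::] => oeq c oone
  | a :: l' => exists d, nprods l' d /\ nprod a d c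
  end.

Definition inf_indecomposable (a : Ord) : Prop :=
  exists b, ole oone b /\ oeq a (oexpw b).

Definition CNF_exponents_infinite (a : Ord) : Prop :=
  (exists bs, is_CNF a bs) /\
  forall bs, is_CNF a bs -> forall b, List.In b bs -> ole oomega b.

(* rank of a node = strict sup of the ranks of its children; R y x means
   "y is a child of x". *)
Fixpoint rk (T : Type) (R : T -> T -> Prop) (x : T) (h : Acc R x) {struct h} : Ord :=
  match h with
  | Acc_intro H =>
      osup (fun y : {y : T | R y x} => rk (H (proj1_sig y) (proj2_sig y)))
  end.

Definition is_rank (T : Type) (R : T -> T -> Prop) (x : T) (a : Ord) : Prop :=
  exists h : Acc R x, oeq (rk h) a.

Definition quasi_order (X : Type) (le : X -> X -> Prop) : Prop :=
  (forall x, le x x) /\ (forall x y z, le x y -> le y z -> le x z).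

Definition wqo (X : Type) (le : X -> X -> Prop) : Prop :=
  quasi_order le /\ forall f : nat -> X, exists i j, (i < j)%N /\ le (f i) (f j).

Definition bad (X : Type) (le : X -> X -> Prop) (t : seq X) : Prop :=
  forall l1 x l2 y l3, t = l1 ++ x :: l2 ++ y :: l3 -> ~ le x y.

Definition antichain (X : Type) (le : X -> X -> Prop) (t : seq X) : Prop :=
  forall l1 x l2 y l3, t = l1 ++ x :: l2 ++ y :: l3 -> ~ le x y /\ ~ le y x.

Definition bad_child (X : Type) (le : X -> X -> Prop) (t s : seq X) : Prop :=
  (exists x, t = rcons s x) /\ bad le t.

Definition antichain_child (X : Type) (le : X -> X -> Prop) (t s : seq X) : Prop :=
  (exists x, t = rcons s x) /\ antichain le t.

(* o(A) = rank of the forest of nonempty finite bad sequences (the roots of the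
   forest are the children of the virtual root [::], so the forest rank is
   the rank of [::]). *)
Definition is_o (X : Type) (le : X -> X -> Prop) (a : Ord) : Prop :=
  is_rank (bad_child le) [::] a.

Definition is_w (X : Type) (le : X -> X -> Prop) (a : Ord) : Prop :=
  is_rank (antichain_child le) [::] a.

Definition prod_le (n : nat) (A : 'I_n -> Type) (le : forall i, A i -> A i -> Prop)
  (x y : forall i, A i) : Prop := forall i, le i (x i) (y i).

(* Main.v *)
(* Upper bound: the width is at most the maximal order type. A set of type
   [sum w^a_i] splits into pieces of type at most [w^a_i], so by distributivity it is
   enough that a product of sets of types at most [w^a] and [w^b] has type at most
   [w^(a (+) b)]; a residual of such a product is covered by products of smaller
   exponent.

   Lower bound: cut each factor into pieces of types [w^a_i], each piece a downward
   closed part of what the earlier ones leave. This cuts the product into boxes, which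
   are visited by increasing exponent. A later element is not above an earlier one,
   because in some coordinate it lies in an earlier piece; it is kept from being below
   one by restricting the indecomposable coordinate to the elements below none of the
   finitely many chosen ones, which does not change the type of that coordinate. Inside
   a single box the same stacking, with [j1] and [j2] alternately cut up and
   restricted, gives width [w^(1 + e)] for types [w^(1 + b)] at [j1], [j2] and [w^b]
   elsewhere, [e] being the natural sum of the [b]'s; the loss of one [1] is harmless
   for infinite exponents. *)

From Stdlib Require Import ClassicalEpsilon.
Require Import Defs.
From Stdlib Require Import Permutation.
From mathcomp Require Import all_boot.

Set Implicit Arguments.
Unset Strict Implicit.
Unset Printing Implicit Defensive.

Arguments oadd : simpl never.
Arguments omul : simpl never.
Arguments oexpw : simpl never.

(** * Ordinals *)

Lemma ole_refl x : ole x x.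
Proof. by elim: x => I f IH i; exists i; apply: IH. Qed.

Lemma ole_trans y x z : ole x y -> ole y z -> ole x z.
Proof.
elim: x y z => I f IH [J g] [K h] xy yz i.
have [j fg] := xy i; have [k gh] := yz j.
by exists k; apply: IH fg gh.
Qed.

Lemma ole_supP I (f : I -> Ord) y : ole (osup f) y <-> forall i, olt (f i) y.
Proof. by case: y. Qed.

Lemma olt_sup I (f : I -> Ord) i : olt (f i) (osup f).
Proof. by exists i; apply: ole_refl. Qed.

Lemma ole_olt_trans y x z : ole x y -> olt y z -> olt x z.
Proof. by case: z => K h xy [k yh]; exists k; apply: ole_trans xy yh. Qed.

Lemma olt_ole_trans y x z : olt x y -> ole y z -> olt x z.
Proof.
case: y z => J g [K h] [j xg] yz; have [k gh] := yz j.
by exists k; apply: ole_trans xg gh.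
Qed.

Lemma oltW x y : olt x y -> ole x y.
Proof.
elim: x y => I f IH [J g] [j xg]; apply/ole_supP => i.
by exists j; apply: IH; apply: olt_ole_trans xg; apply: olt_sup.
Qed.

Lemma olt_trans y x z : olt x y -> olt y z -> olt x z.
Proof. by move=> /oltW xy; apply: ole_olt_trans. Qed.

Lemma ole_ltP x y : ole x y <-> forall z, olt z x -> olt z y.
Proof.
split=> [xy z zx|]; first exact: olt_ole_trans zx xy.
by case: x => I f H; apply/ole_supP => i; apply/H/olt_sup.
Qed.

(** Classical: an [f i] that is not below [y] lies, by induction, strictly above every member of
    [y], so [y <= f i < osup f]. *)
Lemma ole_total x y : ole x y \/ olt y x.
Proof.
elim: x y => I f IH y.
case: (classic (forall i, olt (f i) y)) => [H|/not_all_ex_not [i H]].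
  by left; apply/ole_supP.
right; exists i; case: y H => J g H; apply/ole_supP => j.
by case: (IH i (g j)) => // fg; case: H; exists j.
Qed.

Lemma olt_irrefl x : ~ olt x x.
Proof.
elim: x => I f IH [i H]; apply: (IH i).
by apply: olt_ole_trans H; apply: olt_sup.
Qed.

Lemma olt_nge x y : olt x y -> ~ ole y x.
Proof. by move=> xy yx; apply: (@olt_irrefl x); apply: olt_ole_trans yx. Qed.

Lemma nole_lt x y : ~ ole x y -> olt y x.
Proof. by case: (ole_total x y). Qed.

Lemma olt_ind (P : Ord -> Prop) :
  (forall x, (forall y, olt y x -> P y) -> P x) -> forall x, P x.
Proof.
move=> H x; suff: forall y, ole y x -> P y by apply; apply: ole_refl.
elim: x => I f IH y yx; apply: H => z zy.
by have [i zf] := olt_ole_trans zy yx; apply: IH zf.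
Qed.

Lemma omin_ex (P : Ord -> Prop) x :
  P x -> exists y, P y /\ forall z, P z -> ole y z.
Proof.
elim/olt_ind: x => x IH Px.
case: (classic (exists2 y, olt y x & P y)) => [[y yx Py]|H]; first exact: IH Py.
exists x; split=> // z Pz; case: (ole_total x z) => // zx.
by case: H; exists z.
Qed.

Lemma ole_max x y : exists2 z, ole x z /\ ole y z & z = x \/ z = y.
Proof.
case: (ole_total x y) => [xy|/oltW yx].
  by exists y; [split=> //; apply: ole_refl | right].
by exists x; [split=> //; apply: ole_refl | left].
Qed.

Lemma oeq_refl x : oeq x x.
Proof. by split; apply: ole_refl. Qed.

Lemma oeq_sym x y : oeq x y -> oeq y x.
Proof. by case. Qed.

Lemma oeq_trans y x z : oeq x y -> oeq y z -> oeq x z.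
Proof.
by move=> [xy yx] [yz zy]; split; [apply: ole_trans xy yz|apply: ole_trans zy yx].
Qed.

Lemma ole0x x : ole ozero x.
Proof. by apply/ole_supP; case. Qed.

Lemma olt0 x : ~ olt x ozero.
Proof. by case. Qed.

Lemma olt_succ x : olt x (osucc x).
Proof. by exists tt; apply: ole_refl. Qed.

Lemma ole_succ_lt x y : ole (osucc x) y <-> olt x y.
Proof. by split=> [/ole_supP|H]; [apply; exact: tt | apply/ole_supP]. Qed.

Lemma olt_succ_le x y : olt x (osucc y) <-> ole x y.
Proof. by split=> [[]|H] //; exists tt. Qed.

(** * Ordinal addition *)

Lemma ole_oadd x x' y y' :
  ole x x' -> ole y y' -> ole (oadd x y) (oadd x' y').
Proof.
case: x x' => K f [K' f'] xx'; elim: y y' => J g IH [J' g'] yy'.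
case=> [k|j]; first by have [k' H] := xx' k; exists (inl k').
by have [j' H] := yy' j; exists (inr j'); apply: IH.
Qed.

Lemma olt_oaddP z x y :
  olt z (oadd x y) <-> olt z x \/ exists2 y', olt y' y & ole z (oadd x y').
Proof.
case: x y => K f [J g]; split.
  case=> -[k|j] H; first by left; exists k.
  by right; exists (g j) => //; apply: olt_sup.
case=> [[k H]|[y' [j yg] H]]; first by exists (inl k).
by exists (inr j); apply: ole_trans H _; apply: ole_oadd => //; apply: ole_refl.
Qed.

Lemma olt_oadd2l x y y' : olt y y' -> olt (oadd x y) (oadd x y').
Proof. by move=> H; apply/olt_oaddP; right; exists y => //; apply: ole_refl. Qed.

Lemma ole_addr x y : ole x (oadd x y).
Proof. by apply/ole_ltP => z H; apply/olt_oaddP; left. Qed.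

Lemma ole_addl x y : ole y (oadd x y).
Proof.
elim/olt_ind: y => y IH; apply/ole_ltP => z zy; apply/olt_oaddP; right.
by exists z => //; apply: IH.
Qed.

Lemma oadd0r x : ole (oadd x ozero) x.
Proof. by apply/ole_ltP => z /olt_oaddP [//|[y' /olt0]]. Qed.

Lemma oadd0l x : ole (oadd ozero x) x.
Proof.
elim/olt_ind: x => x IH; apply/ole_ltP => z /olt_oaddP [/olt0 //|[y yx zy]].
by apply: (ole_olt_trans _ yx); apply: ole_trans zy (IH _ yx).
Qed.

Lemma oaddA_le x y z : ole (oadd x (oadd y z)) (oadd (oadd x y) z).
Proof.
elim/olt_ind: z => z IH; apply/ole_ltP => w /olt_oaddP [wx|[u uyz wu]].
  apply: olt_ole_trans wx _; apply: ole_trans (ole_addr _ y) (ole_addr _ _).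
apply: ole_olt_trans wu _; case/olt_oaddP: uyz => [uy|[z' zz' uz]].
  apply: olt_ole_trans (ole_addr _ z); exact: olt_oadd2l.
apply: (ole_olt_trans _ (olt_oadd2l _ zz')); apply: ole_trans (IH _ zz').
by apply: ole_oadd => //; apply: ole_refl.
Qed.

Lemma oaddA_ge x y z : ole (oadd (oadd x y) z) (oadd x (oadd y z)).
Proof.
elim/olt_ind: z => z IH; apply/ole_ltP => w /olt_oaddP [wxy|[z' zz' wz]].
  by apply: olt_ole_trans wxy _; apply: ole_oadd (ole_refl _) (ole_addr _ _).
apply: ole_olt_trans wz _; apply: (ole_olt_trans (IH _ zz')).
by do 2!apply: olt_oadd2l.
Qed.

Lemma osub_ex x y : ole x y -> exists z, oeq (oadd x z) y.
Proof.
move=> xy; have [z [yz zmin]] := @omin_ex (fun z => ole y (oadd x z)) y (ole_addl _ _).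
exists z; split=> //; apply/ole_ltP => w /olt_oaddP [wx|[z' zz' wz']].
  exact: olt_ole_trans wx xy.
apply: ole_olt_trans wz' _; apply: nole_lt => /zmin; exact: olt_nge.
Qed.

(** * Finite multiples *)

Lemma omul_0 x : ole (omul x (ofin 0)) ozero.
Proof. by case: x => K f; apply/ole_supP; case. Qed.

Lemma omul_S x n : oeq (omul x (ofin n.+1)) (oadd (omul x (ofin n)) x).
Proof.
case: x => K f; split; apply/ole_ltP => z.
  case=> -[[] k] H; apply: ole_olt_trans H _.
  exact: (@olt_oadd2l _ _ (osup f) (olt_sup f k)).
set x := osup f; case/olt_oaddP => [zx|[x' [k xk] zx]].
  (* The family of [omul x (ofin n.+1)] is indexed through [K]; an inhabitant is read off the index
     showing that [z] is below [omul x (ofin n)]. *)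
  have [k _] : exists k : K, True.
    by move: zx; case: (ofin n) => J g [[j k] _]; exists k.
  apply: (@olt_ole_trans (oadd (omul x (ofin n)) (f k))).
    by apply: olt_ole_trans zx (ole_addr _ _).
  by apply: oltW; exists (tt, k); apply: ole_refl.
exists (tt, k); apply: ole_trans zx _; exact: ole_oadd (ole_refl _) xk.
Qed.

Lemma ole_omul_l x x' n : ole x x' -> ole (omul x (ofin n)) (omul x' (ofin n)).
Proof.
move=> xx'; elim: n => [|n IH]; first exact: ole_trans (omul_0 _) (ole0x _).
apply: ole_trans (omul_S _ _).1 _; apply: ole_trans (omul_S _ _).2.
exact: ole_oadd.
Qed.

Lemma omul_1 x : ole x (omul x (ofin 1)).
Proof. exact: ole_trans (ole_addl _ _) (omul_S _ _).2. Qed.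

Lemma omul_add x m n :
  ole (oadd (omul x (ofin m)) (omul x (ofin n))) (omul x (ofin (m + n))).
Proof.
elim: n => [|n IH].
  rewrite addn0; apply: ole_trans (oadd0r _).
  exact: ole_oadd (ole_refl _) (omul_0 _).
rewrite addnS; apply: ole_trans (omul_S _ _).2.
apply: ole_trans (ole_oadd IH (ole_refl _)).
apply: ole_trans (oaddA_le _ _ _); exact: ole_oadd (ole_refl _) (omul_S _ _).1.
Qed.

Lemma omul_osum x n : ole (omul x (ofin n)) (osum (nseq n x)).
Proof.
elim: n => [|n IH]; first exact: omul_0.
suff comm m : ole (oadd (osum (nseq m x)) x) (osum (nseq m.+1 x)).
  apply: ole_trans (comm _); apply: ole_trans (omul_S _ _).1 _.
  exact: ole_oadd IH (ole_refl _).
elim: m => [|m IHm] /=; first exact: ole_trans (oadd0l _) (ole_addr _ _).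
exact: ole_trans (oaddA_ge _ _ _) (ole_oadd (ole_refl _) IHm).
Qed.

(** * Powers of omega *)

Lemma ole_oexpw a b : ole a b -> ole (oexpw a) (oexpw b).
Proof.
elim: a b => K f IH [J g] ab; case=> [[k n]|]; last by exists None; exact: (ole_refl ozero).
by have [j fg] := ab k; exists (Some (j, n)); apply: ole_omul_l; apply: IH.
Qed.

Lemma oexpw_gt0 a : olt ozero (oexpw a).
Proof. by case: a => K f; exists None; exact: (ole_refl ozero). Qed.

Lemma olt_omul_oexpw c a n : olt c a -> olt (omul (oexpw c) (ofin n)) (oexpw a).
Proof.
by case: a => K f [k ck]; exists (Some (k, n)); apply: ole_omul_l; apply: ole_oexpw.
Qed.

Lemma olt_oexpw c a : olt c a -> olt (oexpw c) (oexpw a).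
Proof. by move=> /(olt_omul_oexpw 1); apply: ole_olt_trans (omul_1 _). Qed.

Lemma oexpw_0 : ole (oexpw ozero) oone.
Proof. by apply/ole_supP => -[[[]]|]; apply: olt_succ. Qed.

Lemma olt_oexpwP z a : olt z (oexpw a) ->
  ole z ozero \/ exists c n, olt c a /\ ole z (omul (oexpw c) (ofin n)).
Proof.
case: a => K f [[[k n]|] H]; last by left.
by right; exists (f k), n; split=> //; apply: olt_sup.
Qed.

Lemma oadd_lt_oexpw a x y :
  olt x (oexpw a) -> olt y (oexpw a) -> olt (oadd x y) (oexpw a).
Proof.
move=> xa /olt_oexpwP [y0|[d [m [da ym]]]].
  apply: ole_olt_trans xa; apply: ole_trans (oadd0r _); exact: ole_oadd (ole_refl _) y0.
case/olt_oexpwP: xa => [x0|[c [n [ca xn]]]].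
  apply: ole_olt_trans (olt_omul_oexpw m da).
  apply: ole_trans (oadd0l _); exact: ole_oadd x0 ym.
have [e [ce de] He] := ole_max c d.
have ea : olt e a by case: He => ->.
apply: ole_olt_trans (olt_omul_oexpw (n + m) ea).
apply: ole_trans (omul_add _ _ _); apply: ole_oadd.
  by apply: ole_trans xn _; apply: ole_omul_l; apply: ole_oexpw.
by apply: ole_trans ym _; apply: ole_omul_l; apply: ole_oexpw.
Qed.

Lemma oadd_absorb a x : olt x (oexpw a) -> ole (oadd x (oexpw a)) (oexpw a).
Proof.
move=> xa; apply/ole_ltP => z /olt_oaddP [zx|[y ya zy]]; first exact: olt_trans zx xa.
apply: ole_olt_trans zy _; exact: oadd_lt_oexpw.
Qed.

Lemma ole_oexpw_self a : ole a (oexpw a).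
Proof.
elim/olt_ind: a => a IH; apply/ole_ltP => z za.
by apply: ole_olt_trans (olt_oexpw za); apply: IH.
Qed.

Lemma omul_lt_indec x c n : olt ozero x -> olt c x ->
  (forall y z, olt y x -> olt z x -> olt (oadd y z) x) -> olt (omul c (ofin n)) x.
Proof.
move=> x0 cx H; elim: n => [|n IH]; first exact: ole_olt_trans (omul_0 _) x0.
apply: ole_olt_trans (omul_S _ _).1 _; exact: H.
Qed.

(** For the least [e] with [x <= oexpw e], every [c < e] has [oexpw c < x], and closure under
    addition keeps the finite multiples of [oexpw c] below [x]; these and zero are cofinal in
    [oexpw e]. *)
Lemma indec_oexpw x : olt ozero x ->
  (forall y z, olt y x -> olt z x -> olt (oadd y z) x) -> exists e, oeq x (oexpw e).
Proof.
move=> x0 H.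
have [e [xe emin]] := @omin_ex (fun e => ole x (oexpw e)) x (ole_oexpw_self x).
exists e; split=> //; apply/ole_ltP => z /olt_oexpwP [z0|[c [n [ce zc]]]].
  exact: ole_olt_trans z0 x0.
apply: ole_olt_trans zc _; apply: omul_lt_indec => //.
by apply: nole_lt => /emin; apply: olt_nge.
Qed.

(** * Cantor normal forms *)

Definition cnf (l : seq Ord) : Ord := osum (map oexpw l).

Lemma nonincr_cons a l : nonincr (a :: l) <->
  nonincr l /\ forall b, List.In b l -> ole b a.
Proof.
split; last by case: l => [|b l] [ni H] //=; split=> //; apply: H; left.
elim: l a => [|b l IH] a; first by split.
case=> ba ni; split=> // c [<- //|cl]; apply: ole_trans ba.
by have [_] := IH _ ni; apply.
Qed.

Lemma osum_cat l1 l2 : oeq (osum (l1 ++ l2)) (oadd (osum l1) (osum l2)).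
Proof.
elim: l1 => [|a l [IH1 IH2]] /=; first by split; [apply: ole_addl | apply: oadd0l].
split; first exact: ole_trans (ole_oadd (ole_refl _) IH1) (oaddA_le _ _ _).
exact: ole_trans (oaddA_ge _ _ _) (ole_oadd (ole_refl _) IH2).
Qed.

(** A new leading term either is at least the next one or is absorbed by it. *)
Lemma cnf_normalize l : exists2 l', nonincr l' & oeq (cnf l) (cnf l').
Proof.
elim: l => [|a l [l' ni [H1 H2]]]; first by exists [::] => //; apply: oeq_refl.
have E : oeq (cnf (a :: l)) (oadd (oexpw a) (cnf l')).
  by split; apply: ole_oadd => //; apply: ole_refl.
case: l' ni {H1 H2} E => [|b l'] ni E; first by exists [:: a].
case: (ole_total b a) => [ba|ab]; first by exists [:: a, b & l'].
exists (b :: l') => //; apply: oeq_trans E _; split; last exact: ole_addl.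
apply: ole_trans (oaddA_le _ _ _) _; apply: ole_oadd (ole_refl _).
exact/oadd_absorb/olt_oexpw.
Qed.

(** By induction: [a] is zero, or additively indecomposable and so a power of omega, or a sum of two
    smaller ordinals, whose lists are concatenated. *)
Lemma cnf_ex a : exists bs, is_CNF a bs.
Proof.
suff [l al] : exists l, oeq a (cnf l).
  have [l' ni ll'] := cnf_normalize l; exists l'; split=> //; exact: oeq_trans al ll'.
elim/olt_ind: a => a IH.
case: (ole_total a ozero) => [a0|a0]; first by exists [::]; split=> //; apply: ole0x.
case: (classic (forall y z, olt y a -> olt z a -> olt (oadd y z) a)).
  case/(indec_oexpw a0) => e [ae ea]; exists [:: e]; split.
    exact: ole_trans ae (ole_addr _ _).
  exact: ole_trans (oadd0r _) ea.
move=> H; have [y [z [ya [za yz]]]] :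
    exists y z, olt y a /\ olt z a /\ ole a (oadd y z).
  apply: NNPP => N; apply: H => y z ya za; apply: nole_lt => yz.
  by apply: N; exists y, z.
(* Only [a <= y + z] is known. Subtracting [y] makes the decomposition exact, and its second summand
   cannot exceed [z], since [y + z] would then be below [a]. *)
have [z' [yz1 yz2]] := osub_ex (oltW ya).
have za' : olt z' a.
  apply: ole_olt_trans za; case: (ole_total z' z) => // /(olt_oadd2l y) zz'.
  by case: (olt_nge (olt_ole_trans zz' yz1)).
have [l1 [H1 H1']] := IH _ ya; have [l2 [H2 H2']] := IH _ za'.
have [C C'] := osum_cat (map oexpw l1) (map oexpw l2).
exists (l1 ++ l2); rewrite /cnf map_cat; split.
  apply: ole_trans yz2 _; exact: ole_trans (ole_oadd H1 H2) C'.
apply: ole_trans yz1; exact: ole_trans C (ole_oadd H1' H2').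
Qed.

(** * Natural sum *)

(** The Hessenberg sum as the least ordinal above all sums with one argument lowered. This form
    matches the recursion of ranks under unions; [nsum_oplus] relates it to normal forms. *)
Fixpoint oplus (x : Ord) : Ord -> Ord :=
  match x with
  | @osup K f =>
    fix oplus_f (y : Ord) : Ord :=
      match y with
      | @osup J g =>
        osup (fun s : K + J =>
                match s with inl i => oplus (f i) y | inr j => oplus_f (g j) end)
      end
  end.

Lemma ole_oplus x x' y y' : ole x x' -> ole y y' -> ole (oplus x y) (oplus x' y').
Proof.
elim: x x' y y' => I f IHx [I' f'] y y' xx'.
elim: y y' => J g IHy [J' g'] yy' [i|j].
  by have [i' H] := xx' i; exists (inl i'); apply: IHx.
by have [j' H] := yy' j; exists (inr j'); apply: IHy.
Qed.

Lemma olt_oplusP z x y : olt z (oplus x y) <->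
  (exists2 x', olt x' x & ole z (oplus x' y)) \/
  (exists2 y', olt y' y & ole z (oplus x y')).
Proof.
case: x y => I f [J g]; split.
  case=> -[i|j] H; first by left; exists (f i) => //; apply: olt_sup.
  by right; exists (g j) => //; apply: olt_sup.
case=> -[w [i wi] H].
  by exists (inl i); exact: (ole_trans H (ole_oplus wi (ole_refl (osup g)))).
by exists (inr i); exact: (ole_trans H (ole_oplus (ole_refl (osup f)) wi)).
Qed.

Lemma olt_oplus2l x y y' : olt y y' -> olt (oplus x y) (oplus x y').
Proof. by move=> H; apply/olt_oplusP; right; exists y => //; apply: ole_refl. Qed.

Lemma olt_oplus2r x x' y : olt x x' -> olt (oplus x y) (oplus x' y).
Proof. by move=> H; apply/olt_oplusP; left; exists x => //; apply: ole_refl. Qed.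

Lemma oplusC x y : ole (oplus x y) (oplus y x).
Proof.
elim/olt_ind: x y => x IHx; elim/olt_ind => y IHy.
apply/ole_ltP => z /olt_oplusP [[x' H zx]|[y' H zy]]; apply: ole_olt_trans.
- exact: ole_trans zx (IHx _ H _).
- exact: olt_oplus2l.
- exact: ole_trans zy (IHy _ H).
- exact: olt_oplus2r.
Qed.

Lemma oplusA_ge x y z : ole (oplus (oplus x y) z) (oplus x (oplus y z)).
Proof.
elim/olt_ind: x y z => x IHx; elim/olt_ind => y IHy; elim/olt_ind => z IHz.
apply/ole_ltP => w /olt_oplusP [[u ux wu]|[z' zz wz]]; last first.
  by apply: (ole_olt_trans (ole_trans wz (IHz _ zz))); do 2!apply: olt_oplus2l.
apply: ole_olt_trans wu _; case/olt_oplusP: ux => -[v H uv].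
  apply: (ole_olt_trans _ (olt_oplus2r _ H)); apply: ole_trans (IHx _ H _ _).
  exact: ole_oplus uv (ole_refl _).
apply: (@ole_olt_trans (oplus x (oplus v z))); last exact/olt_oplus2l/olt_oplus2r.
apply: ole_trans (IHy _ H _); exact: ole_oplus uv (ole_refl _).
Qed.

Lemma oplusA_le x y z : ole (oplus x (oplus y z)) (oplus (oplus x y) z).
Proof.
apply: ole_trans (oplusC _ _) _.
apply: ole_trans (ole_oplus (oplusC _ _) (ole_refl _)) _.
apply: ole_trans (oplusA_ge _ _ _) _; apply: ole_trans (oplusC _ _) _.
exact: ole_oplus (oplusC _ _) (ole_refl _).
Qed.

Lemma oadd_le_oplus x y : ole (oadd x y) (oplus x y).
Proof.
have le_l u v : ole u (oplus u v).
  elim/olt_ind: u => u IH; apply/ole_ltP => z zu.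
  by apply: (ole_olt_trans _ (olt_oplus2r _ zu)); apply: IH.
elim/olt_ind: y => y IH; apply/ole_ltP => z /olt_oaddP [zx|[y' H zy]].
  exact: olt_ole_trans zx (le_l _ _).
apply: (ole_olt_trans _ (olt_oplus2l _ H)); exact: ole_trans zy (IH _ H).
Qed.

Lemma ole_oplusl x y : ole x (oplus x y).
Proof. exact: ole_trans (ole_addr _ _) (oadd_le_oplus _ _). Qed.

Lemma ole_oplusr x y : ole y (oplus x y).
Proof. exact: ole_trans (ole_addl _ _) (oadd_le_oplus _ _). Qed.

Lemma oplus0r x : ole (oplus x ozero) x.
Proof.
elim/olt_ind: x => x IH; apply/ole_ltP => z /olt_oplusP [[u H zu]|[u /olt0 //]].
by apply: (ole_olt_trans _ H); apply: ole_trans zu (IH _ H).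
Qed.

Lemma oplus0l x : ole (oplus ozero x) x.
Proof. exact: ole_trans (oplusC _ _) (oplus0r _). Qed.

Arguments oplus : simpl never.

(* Equivalent to [x] being [oexpw b] times some ordinal, without mentioning the
   quotient. *)
Definition oexpw_multiple (b x : Ord) : Prop :=
  forall y, olt y x -> ole (oadd y (oexpw b)) x.

Lemma oexpw_multiple_oexpw b c : ole b c -> oexpw_multiple b (oexpw c).
Proof.
move=> bc y yc; apply: ole_trans (oadd_absorb yc).
exact: ole_oadd (ole_refl _) (ole_oexpw bc).
Qed.

Lemma oexpw_multiple_add b x y :
  oexpw_multiple b x -> oexpw_multiple b y -> oexpw_multiple b (oadd x y).
Proof.
move=> mx my z /olt_oaddP [zx|[y' yy' zy]]; first exact: ole_trans (mx _ zx) (ole_addr _ _).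
apply: ole_trans (ole_oadd zy (ole_refl _)) _; apply: ole_trans (oaddA_ge _ _ _) _.
exact: ole_oadd (ole_refl _) (my _ yy').
Qed.

Lemma oexpw_multiple0 b : oexpw_multiple b ozero.
Proof. by move=> y /olt0. Qed.

Lemma oexpw_multiple_omul b n : oexpw_multiple b (omul (oexpw b) (ofin n)).
Proof.
elim: n => [|n IH] y; first by move/olt_ole_trans=> /(_ _ (omul_0 _)) /olt0.
move=> H; apply: ole_trans (omul_S _ _).2.
apply: oexpw_multiple_add IH (oexpw_multiple_oexpw (ole_refl _)) _ _.
exact: olt_ole_trans H (omul_S _ _).1.
Qed.

(** Division by [oexpw b] with remainder. If [x] is not a multiple, some [y < x] has
    [x < y + oexpw b], and the multiple found below [y] serves, since the remainder of [y] is
    absorbed. *)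
Lemma oexpw_multiple_below b x :
  exists m, [/\ oexpw_multiple b m, ole m x & olt x (oadd m (oexpw b))].
Proof.
elim/olt_ind: x => x IH.
case: (classic (oexpw_multiple b x)) => [mx|nmx].
  exists x; split=> //; first exact: ole_refl.
  by apply: ole_olt_trans (ole_addr x ozero) _; apply/olt_oadd2l/oexpw_gt0.
have [y [yx xy]] : exists y, olt y x /\ olt x (oadd y (oexpw b)).
  apply: NNPP => N; apply: nmx => y yx; case: (ole_total (oadd y (oexpw b)) x) => // H.
  by case: N; exists y.
have [m [mm my ym]] := IH _ yx; exists m; split=> //.
  exact: ole_trans my (oltW yx).
apply: olt_ole_trans xy _.
case/olt_oaddP: ym => [/olt_nge //|[d db yd]].
apply: ole_trans (ole_oadd yd (ole_refl _)) _; apply: ole_trans (oaddA_ge _ _ _) _.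
exact: ole_oadd (ole_refl _) (oadd_absorb db).
Qed.

Definition oplus_closed (x : Ord) : Prop :=
  forall y z, olt y x -> olt z x -> olt (oplus y z) x.

(** Closure of [oexpw b] is assumed because this lemma is used inside the induction proving it.
    Lowering [x] leaves a smaller multiple [m] plus some [d < oexpw b], and [m + oexpw b <= x]. *)
Lemma oplus_multiple_closed b x y : oplus_closed (oexpw b) ->
  oexpw_multiple b x -> ole y (oexpw b) -> ole (oplus x y) (oadd x y).
Proof.
move=> cb; elim/olt_ind: x y => x IHx; elim/olt_ind => y IHy mx yb.
apply/ole_ltP => w /olt_oplusP [[x' xx wx]|[y' yy wy]]; apply: ole_olt_trans.
- exact: wx.
- have [m [mm mx' /olt_oaddP H]] := oexpw_multiple_below b x'.
  have [d db xd] : exists2 d, olt d (oexpw b) & ole x' (oadd m d).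
    by case: H => [/olt_nge|//].
  have mlt := ole_olt_trans mx' xx.
  apply: (@ole_olt_trans (oplus (oplus m d) y)).
    apply: ole_oplus (ole_refl _); exact: ole_trans xd (oadd_le_oplus _ _).
  (* If [y] is all of [oexpw b], it fills the gap from [m] up to [x] and [d] stays as a remainder
     below [y]; otherwise [d] and [y] together remain below [oexpw b]. *)
  case: (ole_total (oexpw b) y) => [by_|yb'].
    apply: (@ole_olt_trans (oplus (oplus m y) d)).
      apply: ole_trans (oplusA_ge _ _ _) _; apply: ole_trans (oplusA_le _ _ _).
      exact: ole_oplus (ole_refl _) (oplusC _ _).
    have db' := olt_ole_trans db by_.
    apply: ole_olt_trans (olt_oadd2l x db').
    apply: ole_trans (IHy _ db' mx (oltW db)); apply: ole_oplus (ole_refl _).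
    apply: ole_trans (IHx _ mlt _ mm yb) _.
    apply: ole_trans (mx _ mlt); exact: ole_oadd (ole_refl _) yb.
  apply: ole_olt_trans (oplusA_ge _ _ _) _.
  have dy := cb _ _ db yb'.
  apply: ole_olt_trans (IHx _ mlt _ mm (oltW dy)) _.
  apply: olt_ole_trans (olt_oadd2l _ dy) _.
  exact: ole_trans (mx _ mlt) (ole_addr _ _).
- exact: ole_trans wy (IHy _ yy mx (ole_trans (oltW yy) yb)).
- exact: olt_oadd2l.
Qed.

(** Nonzero arguments lie under finite multiples of a common [oexpw e] with [e < b]; copies of
    [oexpw e] are added one by one, where natural and ordinary sums agree by induction. *)
Lemma oexpw_oplus_closed b : oplus_closed (oexpw b).
Proof.
elim/olt_ind: b => b IH y z yb /olt_oexpwP [z0|[d [m [db zm]]]].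
  apply: ole_olt_trans yb; apply: ole_trans (oplus0r _).
  exact: ole_oplus (ole_refl _) z0.
case/olt_oexpwP: yb => [y0|[c [n [cb yn]]]].
  apply: ole_olt_trans (olt_omul_oexpw m db); apply: ole_trans (oplus0l _).
  exact: ole_oplus y0 zm.
have [e [ce de] He] := ole_max c d.
have eb : olt e b by case: He => ->.
apply: ole_olt_trans (olt_omul_oexpw (n + m) eb).
apply: (@ole_trans (oplus (omul (oexpw e) (ofin n)) (omul (oexpw e) (ofin m)))).
  apply: ole_oplus; [apply: ole_trans yn _ | apply: ole_trans zm _];
    exact/ole_omul_l/ole_oexpw.
elim: m {zm} => [|m IHm].
  rewrite addn0; apply: ole_trans (oplus0r _); exact: ole_oplus (ole_refl _) (omul_0 _).
rewrite addnS; apply: ole_trans (omul_S _ _).2.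
apply: ole_trans (oplus_multiple_closed (IH _ eb) (@oexpw_multiple_omul _ _) (ole_refl _)).
apply: ole_trans (ole_oplus IHm (ole_refl _)); apply: ole_trans (oplusA_le _ _ _).
apply: ole_oplus (ole_refl _) _; apply: ole_trans (omul_S _ _).1 (oadd_le_oplus _ _).
Qed.

Lemma oplus_multiple b x : oexpw_multiple b x ->
  ole (oplus x (oexpw b)) (oadd x (oexpw b)).
Proof.
by move=> mx; apply: oplus_multiple_closed (@oexpw_oplus_closed b) mx (ole_refl _).
Qed.

Definition natsum (l : seq Ord) : Ord := foldr oplus ozero (map oexpw l).

Lemma natsum_cat_le l1 l2 : ole (oplus (natsum l1) (natsum l2)) (natsum (l1 ++ l2)).
Proof.
elim: l1 => [|a l IH] /=; first exact: oplus0l.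
exact: ole_trans (oplusA_ge _ _ _) (ole_oplus (ole_refl _) IH).
Qed.

Lemma natsum_cat_ge l1 l2 : ole (natsum (l1 ++ l2)) (oplus (natsum l1) (natsum l2)).
Proof.
elim: l1 => [|a l IH] /=; first exact: ole_oplusr.
exact: ole_trans (ole_oplus (ole_refl _) IH) (oplusA_le _ _ _).
Qed.

Lemma natsum_perm l1 l2 : Permutation l1 l2 -> ole (natsum l1) (natsum l2).
Proof.
elim=> {l1 l2} [|a l l' _ IH|a b l|l l' l'' _ IH1 _ IH2].
- exact: ole_refl.
- exact: ole_oplus (ole_refl _) IH.
- apply: ole_trans (oplusA_le _ _ _) _; apply: ole_trans (oplusA_ge _ _ _).
  exact: ole_oplus (oplusC _ _) (ole_refl _).
- exact: ole_trans IH1 IH2.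
Qed.

Lemma natsum_cnf l : nonincr l -> oeq (natsum l) (cnf l).
Proof.
move=> ni; split; last first.
  elim: l {ni} => [|a l IH]; first exact: (ole_refl ozero).
  exact: ole_trans (oadd_le_oplus _ _) (ole_oplus (ole_refl _) IH).
(* The accumulator [x] holds the larger terms already summed, a multiple of every power still to
   come. *)
suff H x : (forall b, List.In b l -> oexpw_multiple b x) ->
    ole (oplus x (natsum l)) (oadd x (cnf l)).
  apply: ole_trans (ole_oplusr ozero _) _; apply: ole_trans (H _ _) (oadd0l _).
  by move=> b _; apply: oexpw_multiple0.
elim: l x ni => [|a l IH] x ni mx /=.
  exact: ole_trans (oplus0r _) (ole_addr _ _).
have [{}ni la] := (nonincr_cons _ _).1 ni.
apply: ole_trans (oplusA_le _ _ _) _; apply: ole_trans (oaddA_ge _ _ _).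
apply: (@ole_trans (oplus (oadd x (oexpw a)) (natsum l))).
  by apply: ole_oplus (ole_refl _); apply: oplus_multiple; apply: mx; left.
apply: IH => // b bl; apply: oexpw_multiple_add; first by apply: mx; right.
exact/oexpw_multiple_oexpw/la.
Qed.

Lemma natsum_lt e l : (forall a, List.In a l -> olt a e) -> olt (natsum l) (oexpw e).
Proof.
elim: l => [|a l IH] H; first exact: oexpw_gt0.
apply: oexpw_oplus_closed; first by apply/olt_oexpw/H; left.
by apply: IH => b bl; apply: H; right.
Qed.

(** * Ranks of sequence forests *)

Definition after (X : Type) (R : X -> X -> Prop) (S : X -> Prop) (x : X) : X -> Prop :=
  fun y => S y /\ R x y.

(* [rank_ge R S a] and [rank_le R S a] compare [a] with the rank of the forest of
   finite sequences of elements of [S] in which [R x y] holds whenever [x] occurs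
   before [y]. *)
Fixpoint rank_ge (X : Type) (R : X -> X -> Prop) (S : X -> Prop) (a : Ord) : Prop :=
  match a with
  | @osup K f => forall k, exists2 x, S x & rank_ge R (after R S x) (f k)
  end.

Fixpoint rank_le (X : Type) (R : X -> X -> Prop) (S : X -> Prop) (a : Ord) : Prop :=
  match a with
  | @osup K f => forall x, S x -> exists k, rank_le R (after R S x) (f k)
  end.

Lemma rank_ge_mono X (R : X -> X -> Prop) (S T : X -> Prop) a b :
  (forall x, S x -> T x) -> ole b a -> rank_ge R S a -> rank_ge R T b.
Proof.
elim: a b S T => K f IH [J g] S T ST ba Sf j.
have [k gf] := ba j; have [x Sx H] := Sf k.
by exists x; [apply: ST | apply: IH gf H => y [/ST]].
Qed.

Lemma rank_le_preim X Y (f : Y -> X) (R : X -> X -> Prop) (Q : Y -> Y -> Prop)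
    (S : X -> Prop) (T : Y -> Prop) a b :
  (forall y, T y -> S (f y)) -> (forall y z, Q y z -> R (f y) (f z)) ->
  ole a b -> rank_le R S a -> rank_le Q T b.
Proof.
move=> + QR; elim: a b S T => K g IH [J h] S T TS ab Sg y Ty.
have [k H] := Sg _ (TS _ Ty); have [j gh] := ab k; exists j.
by apply: IH gh H => z [/TS Sz /QR].
Qed.

Lemma rank_le_mono X (R : X -> X -> Prop) (S T : X -> Prop) a b :
  (forall x, T x -> S x) -> ole a b -> rank_le R S a -> rank_le R T b.
Proof. by move=> TS; apply: (@rank_le_preim _ _ id). Qed.

Lemma rank_ge_succ X (R : X -> X -> Prop) (S : X -> Prop) a :
  rank_ge R S (osucc a) <-> exists2 x, S x & rank_ge R (after R S x) a.
Proof. by split=> [/(_ tt)|H []]. Qed.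

Lemma rank_ge_intro X (R : X -> X -> Prop) (S : X -> Prop) a :
  (forall b, olt b a -> rank_ge R S (osucc b)) -> rank_ge R S a.
Proof. by case: a => K f H k; apply/rank_ge_succ/H/olt_sup. Qed.

Lemma rank_ge0 X (R : X -> X -> Prop) (S : X -> Prop) : rank_ge R S ozero.
Proof. by case. Qed.

Lemma rank_le_intro X (R : X -> X -> Prop) (S : X -> Prop) a :
  (forall x, S x -> exists2 b, olt b a & rank_le R (after R S x) b) -> rank_le R S a.
Proof.
case: a => K f H x /H [b [k bk] Hb]; exists k.
by apply: rank_le_mono bk Hb.
Qed.

Lemma rank_le_after X (R : X -> X -> Prop) (S : X -> Prop) a x :
  rank_le R S a -> S x -> exists2 b, olt b a & rank_le R (after R S x) b.
Proof. by case: a => K f H /H [k Hk]; exists (f k) => //; apply: olt_sup. Qed.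

Lemma rank_le_empty X (R : X -> X -> Prop) (S : X -> Prop) a :
  (forall x, ~ S x) -> rank_le R S a.
Proof. by move=> H; apply: rank_le_intro => x /H. Qed.

Lemma rank_le0 X (R : X -> X -> Prop) (S : X -> Prop) :
  rank_le R S ozero -> forall x, ~ S x.
Proof. by move=> H x /H [[]]. Qed.

Lemma rank_ge_le X (R : X -> X -> Prop) (S : X -> Prop) a b :
  rank_le R S a -> rank_ge R S b -> ole b a.
Proof.
elim: a b S => K f IH [J g] S Sf Sg j.
have [x Sx H] := Sg j; have [k Hk] := Sf _ Sx.
by exists k; apply: IH Hk H.
Qed.

(** Stated without assuming the forest well-founded; a rank that does not exist counts as at least
    [a]. *)
Lemma rank_dec X (R : X -> X -> Prop) (S : X -> Prop) a :
  rank_ge R S a \/ exists2 b, olt b a & rank_le R S b.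
Proof.
have dec b T : rank_ge R T (osucc b) \/ rank_le R T b.
  elim/olt_ind: b T => b IH T.
  case: (classic (exists2 x, T x & rank_ge R (after R T x) b)) => [|H].
    by left; apply/rank_ge_succ.
  right; apply: rank_le_intro => x Tx; apply: NNPP => N; apply: H; exists x => //.
  apply: rank_ge_intro => c cb; case: (IH _ cb (after R T x)) => // Hc.
  by case: N; exists c.
case: (classic (exists2 b, olt b a & rank_le R S b)) => [|H]; first by right.
left; apply: rank_ge_intro => b ba; case: (dec b S) => // Hb.
by case: H; exists b.
Qed.

(** Each new element comes from [S] or from [T] and lowers the corresponding bound, as in the
    recursion of [oplus]. *)
Lemma rank_le_union X (R : X -> X -> Prop) (S T U : X -> Prop) a b :
  (forall x, U x -> S x \/ T x) ->
  rank_le R S a -> rank_le R T b -> rank_le R U (oplus a b).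
Proof.
elim/olt_ind: a b S T U => a IHa; elim/olt_ind => b IHb S T U UST Sa Tb.
apply: rank_le_intro => x Ux; case: (UST _ Ux) => [Sx|Tx].
  have [a' aa Sa'] := rank_le_after Sa Sx; exists (oplus a' b); first exact: olt_oplus2r.
  apply: (IHa _ aa _ (after R S x) T) => // y [Uy Rxy].
  by case: (UST _ Uy); [left|right].
have [b' bb Tb'] := rank_le_after Tb Tx; exists (oplus a b'); first exact: olt_oplus2l.
apply: (IHb _ bb S (after R T x)) => // y [Uy Rxy].
by case: (UST _ Uy); [left|right].
Qed.

(** Sequences first run through [V], then through [W], where rank [a] is left whatever finite [F]
    was taken. The part played last is the left summand. *)
Lemma rank_ge_stack X (R : X -> X -> Prop) (V W U : X -> Prop) a b :
  (forall x, V x \/ W x -> U x) -> rank_ge R V b ->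
  (forall F, (forall x, List.In x F -> V x) ->
     rank_ge R (fun y => W y /\ forall x, List.In x F -> R x y) a) ->
  rank_ge R U (oadd a b).
Proof.
elim/olt_ind: b V W U => b IH V W U VWU Vb Wa.
apply: rank_ge_intro => c /olt_oaddP [ca|[b' bb cb]].
  apply: rank_ge_mono _ _ (Wa [::] _) => //; last exact/ole_succ_lt.
  by move=> x [Wx _]; apply: VWU; right.
have /rank_ge_succ [x Vx Vb'] : rank_ge R V (osucc b').
  by move: Vb; apply: rank_ge_mono => //; apply/ole_succ_lt.
apply/rank_ge_succ; exists x; first by apply: VWU; left.
apply: (@rank_ge_mono _ _ (after R U x)) cb _ => //.
apply: IH bb (after R V x) (after R W x) _ _ Vb' _.
  by move=> y [[Vy Rxy]|[Wy Rxy]]; split=> //; apply: VWU; [left|right].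
move=> F FV; apply: rank_ge_mono _ (ole_refl _) (Wa (x :: F) _).
  move=> y [Wy H]; split; first by split=> //; apply: H; left.
  by move=> z zF; apply: H; right.
by move=> y [<- //|/FV []].
Qed.

(** * Ranks of tree nodes as ranks of residual sets *)

Definition chain (X : Type) (R : X -> X -> Prop) (t : seq X) : Prop :=
  forall l1 x l2 y l3, t = l1 ++ x :: l2 ++ y :: l3 -> R x y.

Definition chain_child (X : Type) (R : X -> X -> Prop) (t s : seq X) : Prop :=
  (exists x, t = rcons s x) /\ chain R t.

Lemma chain_rcons X (R : X -> X -> Prop) s z :
  chain R (rcons s z) <-> chain R s /\ forall x, List.In x s -> R x z.
Proof.
split.
  move=> H; split=> [l1 x l2 y l3 E|x xs]; last have [l1 [l2 E]] := List.in_split _ _ xs.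
    by apply: (H l1 x l2 y (rcons l3 z)); rewrite E !(rcons_cat, rcons_cons).
  by apply: (H l1 x l2 z [::]); rewrite E rcons_cat rcons_cons cats1.
case=> Hs Hz l1 x l2 y l3; case/lastP: l3 => [|l3 w].
  rewrite cats1 -rcons_cons -rcons_cat => /rcons_inj [E <-]; apply: Hz.
  by rewrite E; apply/List.in_or_app; right; left.
by rewrite -!(rcons_cons, rcons_cat) => /rcons_inj [E _]; apply: Hs E.
Qed.

Definition residual (X : Type) (R : X -> X -> Prop) (s : seq X) : X -> Prop :=
  fun y => forall x, List.In x s -> R x y.

Lemma residual_rcons X (R : X -> X -> Prop) s x y :
  residual R (rcons s x) y <-> after R (residual R s) x y.
Proof.
rewrite -cats1; split=> [H|[H Rxy] z /List.in_app_iff [/H //|[<- //|//]]].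
split=> [z zs|]; apply: H; apply/List.in_app_iff; first by left.
by right; left.
Qed.

Lemma ole_rk X (R : X -> X -> Prop) s (h : Acc (chain_child R) s) a :
  chain R s -> ole a (rk h) <-> rank_ge R (residual R s) a.
Proof.
elim: a s h => K f IH s [H] cs; split=> Hf k.
  have [[t tc] /=] := Hf k; move: (H t tc); case: tc => -[x ->] ct h fk.
  have [_ Rx] := (chain_rcons _ _ _).1 ct; exists x => //.
  apply: rank_ge_mono (ole_refl _) ((IH k _ h ct).1 fk) => y.
  exact: (residual_rcons _ _ _ _).1.
have [x Rx Hx] := Hf k.
have ct : chain R (rcons s x) by apply/chain_rcons.
have c : chain_child R (rcons s x) s by split=> //; exists x.
exists (exist _ (rcons s x) c); apply/IH => //.
by apply: rank_ge_mono (ole_refl _) Hx => y; exact: (residual_rcons _ _ _ _).2.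
Qed.

Lemma chain_nil X (R : X -> X -> Prop) : chain R [::].
Proof. by case. Qed.

(** The upper bound supplies the accessibility that [is_rank] asks for. By conversion, [chain_child]
    is [bad_child] when [R] is [nle le], and [antichain_child] when [R] is incomparability. *)
Lemma is_rank_chain X (R : X -> X -> Prop) a :
  is_rank (chain_child R) [::] a <->
  rank_ge R (fun _ => True) a /\ rank_le R (fun _ => True) a.
Proof.
split=> [[h [ha ah]]|[ga la]].
  split; first exact: rank_ge_mono (ole_refl _) ((ole_rk h _ (@chain_nil _ R)).1 ah).
  case: (rank_dec R (fun _ => True) (osucc a)) => [g|[b /olt_succ_le ba]].
    have /ole_succ_lt/olt_nge [] // : ole (osucc a) (rk h).
    by apply/ole_rk; [exact: chain_nil|apply: rank_ge_mono (ole_refl _) g => x _ y []].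
  by apply: rank_le_mono.
have acc b s : rank_le R (residual R s) b -> Acc (chain_child R) s.
  elim/olt_ind: b s => b IH s Hs; constructor => t [[x ->] /chain_rcons [_ Rx]].
  have [c cb Hc] := rank_le_after Hs Rx; apply: IH cb _ _.
  by apply: rank_le_mono (ole_refl _) Hc => y /residual_rcons.
have h : Acc (chain_child R) [::] by apply: (acc a); apply: rank_le_mono (ole_refl _) la.
exists h; split; last by apply/ole_rk; [exact: chain_nil|apply: rank_ge_mono (ole_refl _) ga => x _ y []].
apply: rank_ge_le la _; apply: rank_ge_mono (ole_refl _) ((ole_rk h _ (@chain_nil _ R)).1 (ole_refl _)).
by [].
Qed.

(** * Maximal order types of subsets *)

Definition nle (X : Type) (le : X -> X -> Prop) (x y : X) : Prop := ~ le x y.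

Definition transrel (X : Type) (le : X -> X -> Prop) : Prop :=
  forall x y z, le x y -> le y z -> le x z.

Definition otype (X : Type) (le : X -> X -> Prop) (S : X -> Prop) (a : Ord) : Prop :=
  rank_ge (nle le) S a /\ rank_le (nle le) S a.

(** The orientation allows a bad sequence to run through [E] first and continue in [D]. *)
Definition sep (X : Type) (le : X -> X -> Prop) (D E : X -> Prop) : Prop :=
  forall x y, D x -> E y -> ~ le y x.

Lemma otype_oeq X (le : X -> X -> Prop) (S : X -> Prop) a b :
  oeq a b -> otype le S a -> otype le S b.
Proof.
move=> [ab ba] [Sa aS]; split; first exact: rank_ge_mono ba Sa.
exact: rank_le_mono ab aS.
Qed.

Lemma otype_exists X (le : X -> X -> Prop) (S : X -> Prop) a :
  otype le S (oexpw a) -> exists x, S x.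
Proof.
case=> Sa _; have /rank_ge_succ [x Sx _] : rank_ge (nle le) S (osucc ozero).
  by apply: rank_ge_mono Sa => //; apply/ole_succ_lt/oexpw_gt0.
by exists x.
Qed.

Lemma rank_ge_sep X (le : X -> X -> Prop) (D E U : X -> Prop) a b :
  (forall x, D x \/ E x -> U x) -> sep le D E ->
  rank_ge (nle le) D a -> rank_ge (nle le) E b -> rank_ge (nle le) U (oadd a b).
Proof.
move=> DEU DE Da Eb; apply: (rank_ge_stack (V := E) (W := D)) Eb _ => [x H|F FE].
  by apply: DEU; case: H; [right|left].
by apply: rank_ge_mono (ole_refl _) Da => x Dx; split=> // y /FE; apply: DE.
Qed.

(* Residuals of bad sequences are downward closed, and those of rank at least [c]
   cannot shrink forever. *)
Lemma otype_trim X (le : X -> X -> Prop) (S : X -> Prop) a c :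
  transrel le -> rank_le (nle le) S a -> rank_ge (nle le) S c ->
  exists D : X -> Prop, [/\ forall x, D x -> S x,
    sep le D (fun x => S x /\ ~ D x) & otype le D c].
Proof.
move=> tr; elim/olt_ind: a S => a IH S Sa Sc.
case: (classic (exists2 x, S x & rank_ge (nle le) (after (nle le) S x) c)) => [[x Sx]|H].
  have [b ba Sb] := rank_le_after Sa Sx.
  case/(IH _ ba _ Sb) => D [DS Dsep Dc]; exists D; split=> //; first by move=> y /DS [].
  move=> y z Dy [Sz nDz] zy; have [_ nxy] := DS _ Dy.
  apply: (Dsep y z Dy) => //; split=> //; split=> // xz.
  by apply: nxy; apply: tr xz zy.
exists S; split=> //; first by move=> x y _ [].
split=> //; case: (rank_dec (nle le) S (osucc c)) => [/rank_ge_succ //|[b bc]].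
by apply: rank_le_mono => //; apply/olt_succ_le.
Qed.

(** Otherwise [S], as a union, would have rank below the natural sum of [oexpw a] and [cnf l], which
    is [cnf (a :: l)]. *)
Lemma rank_ge_setD X (le : X -> X -> Prop) (S D : X -> Prop) a l :
  nonincr (a :: l) -> rank_ge (nle le) S (cnf (a :: l)) ->
  rank_le (nle le) D (oexpw a) ->
  rank_ge (nle le) (fun x => S x /\ ~ D x) (cnf l).
Proof.
move=> ni Sl Da.
case: (rank_dec (nle le) (fun x => S x /\ ~ D x) (cnf l)) => // -[b bl SDb].
have Sb : rank_le (nle le) S (oplus (oexpw a) b).
  by apply: rank_le_union Da SDb => x Sx; case: (classic (D x)) => H; [left|right].
have [ni' _] := (nonincr_cons _ _).1 ni.
case: (olt_nge _ (rank_ge_le Sb Sl)); apply: olt_ole_trans (natsum_cnf ni).1.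
apply: olt_oplus2l; exact: olt_ole_trans bl (natsum_cnf ni').2.
Qed.

(** A piece for the leading exponent is trimmed off; the remainder still has the rank of the tail
    and contains nothing below that piece. *)
Lemma separated_pieces X (le : X -> X -> Prop) (S : X -> Prop) a l :
  transrel le -> nonincr l -> rank_le (nle le) S a -> rank_ge (nle le) S (cnf l) ->
  exists Ds : seq (X -> Prop),
    List.Forall2 (fun D b => (forall x, D x -> S x) /\ otype le D (oexpw b)) Ds l /\
    List.ForallOrdPairs (sep le) Ds.
Proof.
move=> tr; elim: l S => [|b l IH] S ni Sa Sl; first by exists [::]; split; constructor.
have Sb : rank_ge (nle le) S (oexpw b) by apply: rank_ge_mono (ole_addr _ _) Sl.
have [D [DS Dsep Db]] := otype_trim tr Sa Sb.
have SD := rank_ge_setD ni Sl Db.2; have [{}ni _] := (nonincr_cons _ _).1 ni.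
have [|Ds [DsS Dssep]] := IH _ ni _ SD; first by apply: rank_le_mono (ole_refl _) Sa => x [].
exists (D :: Ds); split.
  by constructor=> //; apply: List.Forall2_impl DsS => E c [ES Ec]; split=> // x /ES [].
constructor=> //; elim: DsS => [|E c Es cs [ES _] _ IHE]; constructor=> //.
by move=> x y Dx /ES; apply: Dsep.
Qed.

(** What lies below [x] is covered by the residual of [x], of smaller rank, and the equivalence
    class of [x], of rank at most one, which is below [oexpw c] as [c >= 1]. Removing both cannot
    lower an indecomposable type. *)
Lemma otype_avoid X (le : X -> X -> Prop) (S : X -> Prop) c F :
  transrel le -> ole oone c -> otype le S (oexpw c) -> (forall x, List.In x F -> S x) ->
  otype le (fun y => S y /\ forall x, List.In x F -> ~ le y x) (oexpw c).
Proof.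
move=> tr c1 + FS; elim: F FS => [|x F IH] FS Sc.
  split; first by apply: rank_ge_mono (ole_refl _) Sc.1 => y Sy; split.
  by apply: rank_le_mono (ole_refl _) Sc.2 => y [].
have {}IH := IH (fun y yF => FS y (or_intror yF)) Sc.
have Sx : S x by apply: FS; left.
set T := (fun y => S y /\ forall x, List.In x F -> ~ le y x) in IH.
set U := (fun y => S y /\ forall z, List.In z (x :: F) -> ~ le y z).
have UT y : U y -> T y by case=> Sy H; split=> // z zF; apply: H; right.
split; last exact: rank_le_mono UT (ole_refl _) IH.2.
case: (rank_dec (nle le) U (oexpw c)) => // -[b bc Ub].
have [d dc Sd] := rank_le_after Sc.2 Sx.
pose V y := le x y /\ le y x.
have V1 : rank_le (nle le) V (oexpw ozero).
  apply: rank_le_intro => y [xy yx]; exists ozero; first exact: oexpw_gt0.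
  by apply: rank_le_empty => z [[xz zx]]; apply; apply: tr yx xz.
have V1c : olt (oexpw ozero) (oexpw c) by apply: olt_oexpw; apply/ole_succ_lt.
have Tl : rank_le (nle le) T (oplus b (oplus d (oexpw ozero))).
  apply: (rank_le_union (S := U) (T := fun y => after (nle le) S x y \/ V y)) => //.
    move=> y [Sy H]; case: (classic (le y x)) => yx; last first.
      by left; split=> // z [<- //|/H].
    by right; case: (classic (le x y)) => xy; [right|left].
  exact: rank_le_union Sd V1.
case: (olt_nge _ (rank_ge_le Tl IH.1)).
by do 2!apply: oexpw_oplus_closed => //.
Qed.

(** * Coverings by sets of indecomposable type *)

(** Keeping the list of exponents instead of one bound lets products distribute over the pieces. *)
Fixpoint covered (X : Type) (R : X -> X -> Prop) (S : X -> Prop) (l : seq Ord) : Prop :=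
  match l with
  | [::] => forall x, ~ S x
  | a :: l' => exists2 D : X -> Prop, rank_le R D (oexpw a) &
                 covered R (fun x => S x /\ ~ D x) l'
  end.

Lemma covered_preim X Y (f : Y -> X) (R : X -> X -> Prop) (Q : Y -> Y -> Prop)
    (S : X -> Prop) (T : Y -> Prop) l :
  (forall y, T y -> S (f y)) -> (forall y z, Q y z -> R (f y) (f z)) ->
  covered R S l -> covered Q T l.
Proof.
move=> + QR; elim: l S T => [|a l IH] S T TS /=; first by move=> H x /TS; apply: H.
case=> D Da H; exists (fun y => D (f y)).
  by apply: rank_le_preim QR (ole_refl _) Da.
by apply: IH H => x [/TS].
Qed.

Lemma covered_sub X (R : X -> X -> Prop) (S T : X -> Prop) l :
  (forall x, T x -> S x) -> covered R S l -> covered R T l.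
Proof. by move=> TS; apply: (@covered_preim _ _ id). Qed.

Lemma covered_empty X (R : X -> X -> Prop) (S : X -> Prop) l :
  (forall x, ~ S x) -> covered R S l.
Proof.
elim: l S => //= a l IH S S0; exists S; first exact: rank_le_empty.
by apply: IH => x [/S0].
Qed.

Lemma covered_natsum X (R : X -> X -> Prop) (S : X -> Prop) l :
  covered R S l -> rank_le R S (natsum l).
Proof.
elim: l S => [|a l IH] S; first exact: (@rank_le_empty _ _ _ ozero).
case=> D Da /IH; apply: rank_le_union Da => x Sx.
by case: (classic (D x)) => H; [left|right].
Qed.

Lemma covered_cat X (R : X -> X -> Prop) (S T U : X -> Prop) l1 l2 :
  (forall x, U x -> S x \/ T x) ->
  covered R S l1 -> covered R T l2 -> covered R U (l1 ++ l2).
Proof.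
elim: l1 S U => [|a l IH] S U UST /=.
  by move=> S0; apply: covered_sub => x /UST [/S0|].
case=> D Da H1 H2; exists D => //; apply: IH H1 H2 => x [/UST [Sx|Tx] nDx].
  by left.
by right.
Qed.

(** If [S] reaches rank [oexpw a], a piece of exactly that type is trimmed off; a remainder of rank
    above [cnf l] would, stacked on it, exceed the bound on [S]. *)
Lemma cnf_covered X (le : X -> X -> Prop) (S : X -> Prop) l : transrel le ->
  rank_le (nle le) S (cnf l) -> covered (nle le) S l.
Proof.
move=> tr; elim: l S => [|a l IH] S Sl; first exact: rank_le0 Sl.
case: (rank_dec (nle le) S (oexpw a)) => [Sa|[b ba Sb]]; last first.
  exists S; first exact: rank_le_mono (oltW ba) Sb.
  by apply: covered_empty => x [].
have [D [DS Dsep Da]] := otype_trim tr Sl Sa.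
exists D; first exact: Da.2.
apply: IH; case: (rank_dec (nle le) (fun x => S x /\ ~ D x) (osucc (cnf l))).
  move=> H; have : rank_ge (nle le) S (oadd (oexpw a) (osucc (cnf l))).
    by apply: rank_ge_sep Dsep Da.1 H => x [/DS|[]].
  move/(rank_ge_le Sl) => /(olt_ole_trans (olt_oadd2l _ (olt_succ _))).
  by move/olt_irrefl.
by case=> b /olt_succ_le; apply: rank_le_mono.
Qed.

(** A product order is the meet of its coordinate orders pulled back to one carrier. *)
Definition meet_le (X : Type) (le1 le2 : X -> X -> Prop) (x y : X) : Prop :=
  le1 x y /\ le2 x y.

Definition exp_prod (l1 l2 : seq Ord) : seq Ord := [seq oplus a b | a <- l1, b <- l2].

(** The bound for single pieces is assumed only for exponents in the lists, so that the induction in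
    [rank_le_inter] can supply it. *)
Lemma covered_inter X (le1 le2 : X -> X -> Prop) (S1 S2 : X -> Prop) l1 l2 :
  (forall a b (D1 D2 : X -> Prop), List.In a l1 -> List.In b l2 ->
     rank_le (nle le1) D1 (oexpw a) -> rank_le (nle le2) D2 (oexpw b) ->
     rank_le (nle (meet_le le1 le2)) (fun x => D1 x /\ D2 x) (oexpw (oplus a b))) ->
  covered (nle le1) S1 l1 -> covered (nle le2) S2 l2 ->
  covered (nle (meet_le le1 le2)) (fun x => S1 x /\ S2 x) (exp_prod l1 l2).
Proof.
elim: l1 S1 => [|a l1 IH] S1 H /=; first by move=> S0 _ x [/S0].
case=> D Da H1 H2.
apply: (covered_cat (S := fun x => D x /\ S2 x)
  (T := fun x => (S1 x /\ ~ D x) /\ S2 x)) => [x [S1x S2x]||].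
- by case: (classic (D x)) => Dx; [left|right].
- elim: l2 S2 H H2 {H1 IH} => [|b l2 IH2] S2 H /=; first by move=> S0 x [_ /S0].
  case=> E Eb H2; exists (fun x => D x /\ E x); first by apply: H => //; left.
  apply: covered_sub (IH2 _ _ H2) => [x [[Dx S2x] nDE]|c d D1 D2 ci di].
    by split=> //; split=> // Ex; apply: nDE.
  by apply: H => //; right.
- by apply: IH H1 H2 => c d D1 D2 ci; apply: H; right.
Qed.

Lemma rank_le_lt_oexpw X (le : X -> X -> Prop) (S : X -> Prop) b a : transrel le ->
  olt b (oexpw a) -> rank_le (nle le) S b ->
  exists2 l, (forall c, List.In c l -> olt c a) & covered (nle le) S l.
Proof.
move=> tr /olt_oexpwP [b0|[c [n [ca bn]]]] Sb.
  exists [::] => //; apply: rank_le0; exact: rank_le_mono b0 Sb.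
exists (nseq n c).
  by elim: n {bn} => //= n IH d [<- //|/IH].
apply: cnf_covered => //; rewrite /cnf map_nseq.
by apply: rank_le_mono Sb => //; apply: ole_trans bn (omul_osum _ _).
Qed.

Lemma exp_prod_lt l1 l2 e : (forall a b, List.In a l1 -> List.In b l2 -> olt (oplus a b) e) ->
  forall c, List.In c (exp_prod l1 l2) -> olt c e.
Proof.
elim: l1 => [|a l1 IH] //= H c /List.in_app_iff [|cl]; last first.
  by apply: IH cl => a' b al; apply: H; right.
by case/List.in_map_iff => b [<- bl]; apply: H => //; left.
Qed.

(** After [x], an element fails to be above [x] for one of the two orders. Each residual has a cover
    by smaller exponents, so by induction the two resulting products have covers by exponents below
    [oplus a b]. *)
Lemma rank_le_inter X (le1 le2 : X -> X -> Prop) (S1 S2 : X -> Prop) a b :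
  transrel le1 -> transrel le2 ->
  rank_le (nle le1) S1 (oexpw a) -> rank_le (nle le2) S2 (oexpw b) ->
  rank_le (nle (meet_le le1 le2)) (fun x => S1 x /\ S2 x) (oexpw (oplus a b)).
Proof.
move=> tr1 tr2; elim/olt_ind: a b S1 S2 => a IHa; elim/olt_ind => b IHb S1 S2 S1a S2b.
apply: rank_le_intro => x [S1x S2x].
have [c1 ca T1] := rank_le_after S1a S1x; have [c2 cb T2] := rank_le_after S2b S2x.
have [l1 l1a C1] := rank_le_lt_oexpw tr1 ca T1.
have [l2 l2b C2] := rank_le_lt_oexpw tr2 cb T2.
exists (oplus (natsum (exp_prod l1 [:: b])) (natsum (exp_prod [:: a] l2))).
  apply: oexpw_oplus_closed; apply/natsum_lt/exp_prod_lt => c d.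
    by move=> /l1a H [<-|//]; apply: olt_oplus2r.
  by move=> [<-|//] /l2b; apply: olt_oplus2l.
apply: (rank_le_union (S := fun y => after (nle le1) S1 x y /\ S2 y)
  (T := fun y => S1 y /\ after (nle le2) S2 x y)).
- move=> y [[S1y S2y] nxy]; case: (classic (le1 x y)) => xy.
    by right; split=> //; split=> // xy2; apply: nxy.
  by left.
- apply: covered_natsum; apply: covered_inter C1 _ => [c d D1 D2 /l1a ca' [<-|//]|].
    exact: IHa.
  by exists S2 => // y [].
- apply: covered_natsum; apply: covered_inter _ C2 => [c d D1 D2 [<-|//] /l2b db|].
    exact: IHb.
  by exists S1 => // y [].
Qed.

Lemma covered_meet X (le1 le2 : X -> X -> Prop) (S1 S2 : X -> Prop) l1 l2 :
  transrel le1 -> transrel le2 ->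
  covered (nle le1) S1 l1 -> covered (nle le2) S2 l2 ->
  covered (nle (meet_le le1 le2)) (fun x => S1 x /\ S2 x) (exp_prod l1 l2).
Proof. by move=> tr1 tr2; apply: covered_inter => a b D1 D2 _ _; apply: rank_le_inter. Qed.

(** * Products of Cantor normal forms *)

Lemma FOP_cat T (P : T -> T -> Prop) l1 l2 :
  List.ForallOrdPairs P l1 -> List.ForallOrdPairs P l2 ->
  (forall x y, List.In x l1 -> List.In y l2 -> P x y) ->
  List.ForallOrdPairs P (l1 ++ l2).
Proof.
elim=> {l1} [|x l1 xl1 _ IH] H2 H //=; constructor.
  apply/List.Forall_app; split=> //; apply/List.Forall_forall => y; apply: H; by left.
by apply: IH => // y z yl; apply: H; right.
Qed.

Lemma FOP_map T U (f : T -> U) (P : U -> U -> Prop) l :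
  List.ForallOrdPairs (fun x y => P (f x) (f y)) l -> List.ForallOrdPairs P (map f l).
Proof.
elim=> {l} [|x l xl _ IH] /=; constructor=> //.
by elim: xl {IH} => [|y l' Pxy _ H] /=; constructor.
Qed.

Lemma FOP_impl T (P Q : T -> T -> Prop) l :
  (forall x y, List.In x l -> List.In y l -> P x y -> Q x y) ->
  List.ForallOrdPairs P l -> List.ForallOrdPairs Q l.
Proof.
move=> + H; elim: H => {l} [|x l xl _ IH] H; constructor; last first.
  by apply: IH => y z yl zl; apply: H; right.
apply/List.Forall_forall => y yl; apply: H; [by left|by right|].
by move/List.Forall_forall: xl; apply.
Qed.

Lemma FOP_nth T (P : T -> T -> Prop) x0 l i j : List.ForallOrdPairs P l ->
  i < j -> j < size l -> P (nth x0 l i) (nth x0 l j).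
Proof.
move=> H; elim: H i j => {l} [|x l xl _ IH]; first by move=> i [].
case=> [|i] [|j] //=; last by rewrite !ltnS; apply: IH.
move=> _; elim: xl j {IH} => [|y l' Pxy _ IH] // [|j] //=; rewrite ltnS; exact: IH.
Qed.

Lemma In_mem (T : eqType) (x : T) s : List.In x s <-> x \in s.
Proof.
elim: s => //= y s IH; rewrite inE; split=> [[->|/IH ->]|/predU1P [->|/IH]].
- by rewrite eqxx.
- by rewrite orbT.
- by left.
- by right.
Qed.

Lemma FOP_iota m n : List.ForallOrdPairs (fun i j => i < j) (iota m n).
Proof.
elim: n m => [|n IH] m /=; constructor=> //.
by apply/List.Forall_forall => k /In_mem; rewrite mem_iota => /andP [].
Qed.

Lemma nonincrP l : nonincr l <-> List.ForallOrdPairs (fun a b => ole b a) l.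
Proof.
elim: l => [|a l IH]; first by split; constructor.
split=> [/nonincr_cons [/IH ni H]|H].
  by constructor=> //; apply/List.Forall_forall.
apply/nonincr_cons; inversion_clear H as [|? ? Ha Hl]; split; first exact/IH.
exact/List.Forall_forall.
Qed.

(* Insertion sort by decreasing weight; [P] survives because a pair is swapped
   only if its weights are strictly out of order. *)
Lemma stable_sort T (w : T -> Ord) (P : T -> T -> Prop) l :
  List.ForallOrdPairs (fun x y => P x y /\ (olt (w x) (w y) -> P y x)) l ->
  exists l', Permutation l l' /\
    List.ForallOrdPairs (fun x y => P x y /\ ole (w y) (w x)) l'.
Proof.
elim=> {l} [|x l xl _ [l' [ll' H]]]; first by exists [::]; split; constructor.
suff [l'' [xl'' H'']] : exists l'', Permutation (x :: l') l'' /\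
    List.ForallOrdPairs (fun x y => P x y /\ ole (w y) (w x)) l''.
  by exists l''; split=> //; apply: Permutation_trans xl''; constructor.
have {xl ll'} : forall y, List.In y l' -> P x y /\ (olt (w x) (w y) -> P y x).
  move=> y yl'; move/List.Forall_forall: xl; apply.
  exact: Permutation_in (Permutation_sym ll') yl'.
elim: H => {l'} [|y l' yl' H IH] Hx; first by exists [:: x]; split; repeat constructor.
case: (ole_total (w y) (w x)) => yx.
  exists [:: x, y & l']; split; first exact: Permutation_refl.
  constructor; last by constructor.
  apply/List.Forall_forall => z zl; split; first exact: (Hx z zl).1.
  case: zl => [<- //|zl]; apply: ole_trans yx.
  by move/List.Forall_forall: yl' => /(_ _ zl) [].
have [|l'' [xl'' H'']] := IH; first by move=> z zl; apply: Hx; right.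
exists (y :: l''); split.
  apply: Permutation_trans (perm_swap _ _ _) _; exact: perm_skip.
constructor=> //; apply/List.Forall_forall => z zl.
case: (Permutation_in _ (Permutation_sym xl'') zl) => [<-|zl'].
  by split; [apply: (Hx y _).2 => //; left | apply: oltW].
by move/List.Forall_forall: yl'; apply.
Qed.

Lemma nonincr_sort l : exists2 l', Permutation l l' & nonincr l'.
Proof.
have [|l' [ll' H]] := @stable_sort _ id (fun _ _ => True) l.
  by elim: l => [|a l IH]; constructor=> //; apply/List.Forall_forall.
by exists l' => //; apply/nonincrP; apply: FOP_impl H => x y _ _ [].
Qed.

Lemma perm_oeq_perm l1 l2 : Permutation l1 l2 -> perm_oeq l1 l2.
Proof.
move=> H; exists l2; split=> //.
by elim: (l2) => [|a l IH]; constructor=> //; apply: oeq_refl.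
Qed.

Lemma is_CNF_natsum a l : is_CNF a l -> oeq a (natsum l).
Proof. by case=> ni al; apply: oeq_trans al _; apply/oeq_sym/natsum_cnf. Qed.

Lemma natsum_is_CNF l1 l2 : Permutation l1 l2 -> nonincr l2 -> is_CNF (natsum l1) l2.
Proof.
move=> p ni; split=> //; apply: oeq_trans (natsum_cnf ni).
by split; apply: natsum_perm => //; apply: Permutation_sym.
Qed.

(** Both are the natural sum over the concatenated exponent lists. *)
Lemma nsum_oplus a b : nsum a b (oplus a b).
Proof.
have [la Ha] := cnf_ex a; have [lb Hb] := cnf_ex b.
have [l p ni] := nonincr_sort (la ++ lb).
exists la, lb, l; do 2!split=> //; split; last exact: perm_oeq_perm.
have [_ H] := natsum_is_CNF p ni; split=> //; apply: oeq_trans H.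
have [a1 a2] := is_CNF_natsum Ha; have [b1 b2] := is_CNF_natsum Hb; split.
  exact: ole_trans (ole_oplus a1 b1) (natsum_cat_le _ _).
exact: ole_trans (natsum_cat_ge _ _) (ole_oplus a2 b2).
Qed.

Lemma exp_prod_perm l l1 l2 :
  Permutation l1 l2 -> Permutation (exp_prod l l1) (exp_prod l l2).
Proof.
move=> p; elim: l => [|a l IH]; first exact: Permutation_refl.
by apply: Permutation_app IH; apply: Permutation_map.
Qed.

Lemma exp_prod_nsum l1 l2 :
  List.Forall2 (fun p e => nsum p.1 p.2 e) [seq (x, y) | x <- l1, y <- l2]
    (exp_prod l1 l2).
Proof.
elim: l1 => [|a l1 IH]; first by constructor.
apply: List.Forall2_app IH; elim: l2 => [|b l2 IH]; constructor=> //.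
exact: nsum_oplus.
Qed.

Definition exp_prods (I : Type) (L : I -> seq Ord) (l : seq I) : seq Ord :=
  foldr (fun i => exp_prod (L i)) [:: ozero] l.

Lemma nprods_natsum (I : Type) (o : I -> Ord) (L : I -> seq Ord) l :
  (forall i, is_CNF (o i) (L i)) ->
  nprods [seq o i | i <- l] (natsum (exp_prods L l)).
Proof.
move=> H; elim: l => [|i l IH].
  split; first by apply: ole_trans (oplus0r _) oexpw_0.
  by apply/ole_succ_lt; apply: olt_ole_trans (oexpw_gt0 ozero) (ole_oplusl _ _).
exists (natsum (exp_prods L l)); split=> //.
(* [nprod] takes its factors and result in normal form, so exponents are sorted before and after
   multiplying; natural sums are invariant under permutation. *)
have [ds p ni] := nonincr_sort (exp_prods L l).
have [cs q ni'] := nonincr_sort (exp_prod (L i) ds).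
exists (L i), ds, (exp_prod (L i) ds), cs; split=> //.
split; first exact: natsum_is_CNF.
split; first exact: exp_prod_nsum.
split; last exact: perm_oeq_perm.
by apply: natsum_is_CNF ni'; apply: Permutation_trans q; apply: exp_prod_perm.
Qed.

(** * The upper bound *)

Definition list_le (I : eqType) (A : I -> Type) (le : forall i, A i -> A i -> Prop)
  (l : seq I) (x y : forall i, A i) : Prop := forall i, i \in l -> le i (x i) (y i).

Lemma covered_list_le (I : eqType) (A : I -> Type)
    (le : forall i, A i -> A i -> Prop) (L : I -> seq Ord) (l : seq I) :
  (forall i, transrel (le i)) ->
  (forall i, covered (nle (le i)) (fun _ => True) (L i)) ->
  covered (nle (list_le le l)) (fun _ => True) (exp_prods L l).
Proof.
move=> tr H; elim: l => [|i l IH].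
  (* With no coordinates everything is related, so the rank is at most one, the power with exponent
     zero. *)
  exists (fun _ => True); last by move=> x [].
  apply: rank_le_intro => x _; exists ozero; first exact: oexpw_gt0.
  by apply: rank_le_empty => y [_]; apply.
have tri : transrel (fun x y : forall i, A i => le i (x i) (y i)).
  by move=> x y z; apply: tr.
have trl : transrel (list_le le l).
  by move=> x y z xy yz j jl; apply: tr (xy _ jl) (yz _ jl).
have Hi : covered (nle (fun x y : forall i, A i => le i (x i) (y i)))
    (fun _ => True) (L i).
  by apply: (covered_preim (f := fun x : forall i, A i => x i)) (H i).
apply: (covered_preim (f := id)) (covered_meet tri trl Hi IH) => // x y nxy [xy xyl].
by apply: nxy => j; rewrite inE => /predU1P [->|/xyl].
Qed.

(** * The lower bound *)

Definition incomp (X : Type) (le : X -> X -> Prop) (x y : X) : Prop :=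
  ~ le x y /\ ~ le y x.

(** Pieces are played from the last to the first. A new element is not above an earlier one by
    [sep], and not below one by the choice made against [F]. *)
Lemma width_stack X (le : X -> X -> Prop) (Q : X -> Prop)
    (ps : seq ((X -> Prop) * Ord)) :
  List.ForallOrdPairs (fun p q => sep le p.1 q.1) ps ->
  (forall p, List.In p ps -> (forall x, p.1 x -> Q x) /\
     forall F, (forall x, List.In x F -> Q x) ->
       rank_ge (incomp le) (fun y => p.1 y /\ forall x, List.In x F -> ~ le y x) p.2) ->
  rank_ge (incomp le) (fun x => exists2 p, List.In p ps & p.1 x) (osum (map snd ps)).
Proof.
elim=> {ps} [|p ps pps _ IH] H; first exact: rank_ge0.
apply: (rank_ge_stack (V := fun x => exists2 q, List.In q ps & q.1 x) (W := p.1)).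
- move=> x [[q qps qx]|px]; first by exists q => //; right.
  by exists p => //; left.
- by apply: IH => q qps; apply: H; right.
- move=> F FV; have [_ Hp] := H p (or_introl erefl).
  apply: rank_ge_mono (ole_refl _) (Hp F _).
    move=> y [py nyF]; split=> // x xF; split; last exact: nyF.
    have [q qps qx] := FV _ xF; move/List.Forall_forall: pps => /(_ _ qps); exact.
  by move=> x /FV [q qps qx]; apply: (H q (or_intror qps)).1.
Qed.

Definition box (I : Type) (A : I -> Type) (S : forall i, A i -> Prop)
  (x : forall i, A i) : Prop := forall i, S i (x i).

Definition all_le (I : Type) (A : I -> Type) (le : forall i, A i -> A i -> Prop)
  (x y : forall i, A i) : Prop := forall i, le i (x i) (y i).

Lemma box_exists (I : Type) (A : I -> Type) (S : forall i, A i -> Prop) :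
  (forall i, exists x, S i x) -> exists x, box S x.
Proof.
move=> H; pose c i := constructive_indefinite_description _ (H i).
by exists (fun i => proj1_sig (c i)) => i; apply: proj2_sig (c i).
Qed.

(* Later elements avoid lying below earlier ones through the coordinate [i], which
   keeps its indecomposable type, and above them through separation. *)
Lemma box_stack (I : eqType) (A : I -> Type) (le : forall i, A i -> A i -> Prop)
    (i : I) (T : A i -> Prop) d (qs : seq ((forall i, A i -> Prop) * Ord)) :
  transrel (le i) -> ole oone d -> otype (le i) T (oexpw d) ->
  List.ForallOrdPairs (fun p q => exists j, sep (le j) (p.1 j) (q.1 j)) qs ->
  (forall q, List.In q qs -> (forall x, q.1 i x <-> T x) /\
     forall T', otype (le i) T' (oexpw d) ->
       rank_ge (incomp (all_le le)) (box (dfwith q.1 T')) q.2) ->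
  rank_ge (incomp (all_le le)) (fun x => exists2 q, List.In q qs & box q.1 x)
    (osum (map snd qs)).
Proof.
move=> tr d1 Td qsep H.
pose ps := [seq (box q.1, q.2) | q <- qs].
have -> : map snd qs = map snd ps by rewrite -map_comp.
apply: (@rank_ge_mono _ _ (fun x => exists2 p, List.In p ps & p.1 x)).
- by move=> x [p /List.in_map_iff [q [<- qqs]] qx]; exists q.
- exact: ole_refl.
apply: (width_stack (Q := fun x => T (x i))).
  apply: FOP_map; apply: FOP_impl qsep => p q _ _ [j pq] x y px qy yx.
  exact: pq (px j) (qy j) (yx j).
move=> _ /List.in_map_iff [q [<- qqs]] /=; have [qT Hq] := H _ qqs.
split=> [x qx|F FT]; first exact/qT.
have FT' x : List.In x (map (fun x => x i) F) -> T x.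
  by move=> /List.in_map_iff [y [<- /FT]].
apply: rank_ge_mono (ole_refl _) (Hq _ (otype_avoid tr d1 Td FT')) => y yq.
have := yq i; rewrite dfwith_in => -[Tyi nyi]; split=> [j|x xF yx].
  by have [<-|ij] := eqVneq i j; [apply/qT|have := yq j; rewrite dfwith_out].
by apply: nyi (yx i); apply/List.in_map_iff; exists x.
Qed.

(** As [e < g], coordinate [i] contains [n] separated pieces of type [oexpw e]; the boxes over them
    are stacked, with [j] as the coordinate restricted to avoid earlier elements. *)
Lemma box_width_multiple (I : eqType) (A : I -> Type)
    (le : forall i, A i -> A i -> Prop) (S : forall i, A i -> Prop)
    (i j : I) d e g r n :
  transrel (le i) -> transrel (le j) -> i != j ->
  otype (le i) (S i) (oexpw g) -> olt e g ->
  otype (le j) (S j) (oexpw d) -> ole oone d ->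
  (forall D T, otype (le i) D (oexpw e) -> otype (le j) T (oexpw d) ->
     rank_ge (incomp (all_le le)) (box (dfwith (dfwith S D) T)) r) ->
  rank_ge (incomp (all_le le)) (box S) (omul r (ofin n)).
Proof.
move=> tri trj ij Sg eg Sd d1 H.
have ne c : List.In c (nseq n e) -> c = e by elim: n => //= n IH [<-|/IH].
have ni : nonincr (nseq n e).
  elim: n {ne} => // n IH; apply/nonincr_cons; split=> // b.
  by elim: n {IH} => //= n IH [<-|/IH //]; apply: ole_refl.
have Sn : rank_ge (nle (le i)) (S i) (cnf (nseq n e)).
  apply: rank_ge_mono Sg.1 => //; apply: ole_trans (natsum_cnf ni).2 _.
  by apply/oltW/natsum_lt => c /ne ->.
have [Ds [DS Dsep]] := separated_pieces tri ni Sg.2 Sn.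
pose qs := [seq (dfwith S D, r) | D <- Ds].
have DS' D : List.In D Ds -> (forall x, D x -> S i x) /\ otype (le i) D (oexpw e).
  elim: DS ne {Sn ni Dsep qs} => //= E c Es cs [ES Ec] _ IH ne [<-|]; last first.
    by apply: IH => b bcs; apply: ne; right.
  by rewrite -(ne c) //; left.
have -> : omul r (ofin n) = omul r (ofin (size qs)).
  have E : size Ds = size (nseq n e) := List.Forall2_length DS.
  by rewrite size_map E size_nseq.
apply: (@rank_ge_mono _ _ (fun x => exists2 q, List.In q qs & box q.1 x) _
  (osum (map snd qs))).
- move=> x [_ /List.in_map_iff [D [<- /DS' [DSi _]]] xD] k.
  by have /= := xD k; have [<-|ik] := eqVneq i k; [rewrite dfwith_in => /DSi|rewrite dfwith_out].
- suff -> : map snd qs = nseq (size qs) r by apply: omul_osum.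
  rewrite /qs size_map.
  by elim: (Ds) => //= D l ->.
- apply: (box_stack trj d1 Sd).
  apply: FOP_map; apply: FOP_impl Dsep => D E _ _ DE.
  by exists i; rewrite /= !dfwith_in.
move=> _ /List.in_map_iff [D [<- /DS' [_ De]]] /=; split=> [x|T Td]; last exact: H.
by rewrite dfwith_out.
Qed.

Definition oplus_sum (I : Type) (l : seq I) (b : I -> Ord) : Ord :=
  foldr (fun i => oplus (b i)) ozero l.

Lemma eq_oplus_sum (I : eqType) (l : seq I) b b' :
  {in l, b =1 b'} -> oplus_sum l b = oplus_sum l b'.
Proof.
elim: l => //= i l IH H; rewrite (H i) ?mem_head // IH // => j jl.
by apply: H; rewrite inE jl orbT.
Qed.

(** The recursion of [oplus] lowers one summand; [uniq] makes overriding [b] at [i] affect that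
    summand alone. The cast shows [dfwith] a constant family. *)
Lemma olt_oplus_sum (I : eqType) (l : seq I) (b : I -> Ord) z : uniq l ->
  olt z (oplus_sum l b) -> exists i c, [/\ i \in l, olt c (b i) &
    ole z (oplus_sum l (dfwith b (c : (fun _ => Ord) i)))].
Proof.
elim: l z => [|i l IH] z /=; first by move=> _ /olt0.
case/andP=> il ul /olt_oplusP [[c cb zc]|[y yl zy]].
  exists i, c; split=> //; first exact: mem_head.
  rewrite dfwith_in; apply: ole_trans zc _; apply: ole_oplus (ole_refl _) _.
  rewrite (@eq_oplus_sum _ l _ b); first exact: ole_refl.
  by move=> j jl; rewrite dfwith_out //; apply: contraNneq il => ->.
have [j [c [jl cb yc]]] := IH _ ul yl.
exists j, c; split=> //; first by rewrite inE jl orbT.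
rewrite dfwith_out; last by apply: contraNneq il => <-.
by apply: ole_trans zy _; apply: ole_oplus (ole_refl _) yc.
Qed.

Lemma oplus_sum_dfwith_lt (I : eqType) (l : seq I) (b : I -> Ord) i (c : (fun _ => Ord) i) :
  uniq l -> i \in l -> olt c (b i) -> olt (oplus_sum l (dfwith b c)) (oplus_sum l b).
Proof.
elim: l => //= j l IH /andP [jl ul] /predU1P [ij|il] cb.
  rewrite -ij dfwith_in in jl *; rewrite (@eq_oplus_sum _ l _ b); first exact: olt_oplus2r.
  by move=> k kl; rewrite dfwith_out //; apply: contraNneq jl => ->.
rewrite dfwith_out; first exact/olt_oplus2l/IH.
by apply: contraNneq jl => <-.
Qed.

(* In the induction the exponents at [j1] and [j2] may become finite; writing them
   as [1 + b] keeps these two coordinates infinite, at no cost in the end since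
   [1 + b = b] for infinite [b]. *)
Definition exp1 (I : eqType) (j1 j2 i : I) (a : Ord) : Ord :=
  if (i == j1) || (i == j2) then oadd oone a else a.

Lemma exp1_lt (I : eqType) (j1 j2 i : I) a b :
  olt a b -> olt (exp1 j1 j2 i a) (exp1 j1 j2 i b).
Proof. by rewrite /exp1; case: ifP => // _; apply: olt_oadd2l. Qed.

Lemma exp1_ge1 (I : eqType) (j1 j2 i : I) a :
  (i == j1) || (i == j2) -> ole oone (exp1 j1 j2 i a).
Proof. by rewrite /exp1 => ->; apply: ole_addr. Qed.

(** Finite multiples of [oexpw c] with [c] below the target exponent suffice. Such a [c] is zero or
    comes from lowering one [b i]; cutting coordinate [i] accordingly gives boxes covered by
    induction. *)
Lemma box_width (I : eqType) (A : I -> Type) (le : forall i, A i -> A i -> Prop)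
    (l : seq I) (j1 j2 : I) (b : I -> Ord) (S : forall i, A i -> Prop) :
  (forall i, transrel (le i)) -> uniq l -> j1 != j2 ->
  (forall i, otype (le i) (S i) (oexpw (exp1 j1 j2 i (b i)))) ->
  rank_ge (incomp (all_le le)) (box S) (oexpw (oadd oone (oplus_sum l b))).
Proof.
(* Induction on a bound [s] of the sum leaves [b] and [S] free to vary. *)
move=> tr ul j12; move: {2}(oplus_sum l b) (ole_refl (oplus_sum l b)) => s.
elim/olt_ind: s b S => s IH b S bs Sb.
pose e := exp1 j1 j2.
have H c n : olt c (oadd oone (oplus_sum l b)) ->
    rank_ge (incomp (all_le le)) (box S) (omul (oexpw c) (ofin n)).
  case/olt_oaddP => [/olt_succ_le c0|[y /(olt_oplus_sum ul) [i [b' [il b'b yb]]] cy]].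
    apply: (@rank_ge_mono _ _ (box S) _ (omul (oexpw ozero) (ofin n))) => //.
      exact/ole_omul_l/ole_oexpw.
    (* For [c = 0], coordinate [j1] is cut into pieces of type one, and each nonempty box
       contributes one point. *)
    apply: (box_width_multiple (i := j1) (j := j2) (e := ozero)
      (g := e j1 (b j1)) (d := e j2 (b j2))) => //.
      by apply/ole_succ_lt/exp1_ge1; rewrite eqxx.
      by apply/exp1_ge1; rewrite eqxx orbT.
    move=> D T D0 T2; apply: (rank_ge_mono (S := box (dfwith (dfwith S D) T))) oexpw_0 _ => //.
    apply/(rank_ge_succ _ _ ozero); have [|x Hx] := @box_exists _ _ (dfwith (dfwith S D) T).
      move=> k; have [<-|j2k] := eqVneq j2 k.
        by rewrite dfwith_in; apply: otype_exists T2.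
      rewrite dfwith_out //; have [<-|j1k] := eqVneq j1 k.
        by rewrite dfwith_in; apply: otype_exists D0.
      by rewrite dfwith_out //; apply: otype_exists (Sb k).
    by exists x => //; apply: rank_ge0.
  pose b1 := dfwith b (b' : (fun _ => Ord) i).
  (* The restricted coordinate must differ from the cut one and have a nonzero exponent; two special
     coordinates ensure that one is always available. *)
  pose j := if i == j1 then j2 else j1.
  have ij : i != j by rewrite /j; case: (eqVneq i j1) => [->|].
  have ej : (j == j1) || (j == j2) by rewrite /j; case: ifP; rewrite eqxx ?orbT.
  apply: (@rank_ge_mono _ _ (box S) _
    (omul (oexpw (oadd oone (oplus_sum l b1))) (ofin n))) => //.
    apply/ole_omul_l/ole_oexpw; apply: ole_trans cy _.
    exact: ole_oadd (ole_refl _) yb.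
  apply: (box_width_multiple (i := i) (j := j) (e := e i b')
    (g := e i (b i)) (d := e j (b j))) => //; [exact: exp1_lt|exact: exp1_ge1|].
  move=> D T Di Tj.
  have b1s : olt (oplus_sum l b1) s.
    by apply: olt_ole_trans bs; apply: oplus_sum_dfwith_lt.
  apply: (IH _ b1s b1) => [|k]; first exact: ole_refl.
  have [<-|jk] := eqVneq j k; first by rewrite dfwith_in /b1 dfwith_out.
  rewrite [X in otype _ X _]dfwith_out //.
  by have [<-|ik] := eqVneq i k; rewrite /b1 ?dfwith_in // !dfwith_out.
apply: rank_ge_intro => z /olt_oexpwP [z0|[c [n [cs zn]]]].
  apply: (@rank_ge_mono _ _ (box S) _ (omul (oexpw ozero) (ofin 1))) => //.
    apply/ole_succ_lt; apply: ole_olt_trans z0 _.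
    by apply: olt_ole_trans (omul_1 _); apply: oexpw_gt0.
  by apply: H; apply: olt_ole_trans (ole_addr _ _); apply: olt_succ.
apply: (@rank_ge_mono _ _ (box S) _ (omul (oexpw c) (ofin n.+1))) (H _ _ cs) => //.
apply/ole_succ_lt; apply: ole_olt_trans zn _; apply: olt_ole_trans (omul_S _ _).2.
apply: ole_olt_trans (ole_addr _ ozero) _; exact/olt_oadd2l/oexpw_gt0.
Qed.

(** * Boxes indexed by one piece in each coordinate *)

Definition choices (I : eqType) (m : I -> nat) (l : seq I) : seq (I -> nat) :=
  foldr (fun i ks => [seq dfwith f (k : (fun _ => nat) i) | k <- iota 0 (m i), f <- ks])
    [:: fun _ => 0] l.

Lemma choices_cons (I : eqType) (m : I -> nat) i (l : seq I) f :
  List.In f (choices m (i :: l)) <-> exists k g, [/\ k < m i,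
    List.In g (choices m l) & f = dfwith g (k : (fun _ => nat) i)].
Proof.
rewrite /=; have E k : k < m i <-> List.In k (iota 0 (m i)).
  by split=> [km|/In_mem]; [apply/In_mem|]; rewrite mem_iota.
transitivity (exists k g, [/\ List.In k (iota 0 (m i)),
    List.In g (choices m l) & f = dfwith g (k : (fun _ => nat) i)]); last first.
  by split=> -[k [g [/E]]]; exists k, g.
elim: (iota 0 (m i)) => [|k ks IH] /=; first by split=> // -[k [g []]].
split=> [/List.in_app_iff [/List.in_map_iff [g [<- gl]]|/IH [k' [g [kk gl ->]]]]|].
- by exists k, g; split=> //; left.
- by exists k', g; split=> //; right.
- move=> [k' [g [[<-|kk] gl E']]]; apply/List.in_app_iff.
    by left; apply/List.in_map_iff; exists g.
  by right; apply/IH; exists k', g.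
Qed.

Lemma choices_lt (I : eqType) (m : I -> nat) (l : seq I) f i :
  List.In f (choices m l) -> i \in l -> f i < m i.
Proof.
elim: l f => // j l IH f /choices_cons [k [g [km gl ->]]].
have [<- _|ji] := eqVneq j i; first by rewrite dfwith_in.
by rewrite inE eq_sym (negPf ji) dfwith_out //=; apply: IH.
Qed.

Definition choice_exp (I : Type) (L : I -> seq Ord) (l : seq I) (f : I -> nat) : Ord :=
  oplus_sum l (fun i => nth ozero (L i) (f i)).

Arguments choice_exp : simpl never.

Lemma choice_exp_dfwith (I : eqType) (L : I -> seq Ord) i (l : seq I) f k :
  i \notin l -> choice_exp L (i :: l) (dfwith f (k : (fun _ => nat) i)) =
    oplus (nth ozero (L i) k) (choice_exp L l f).
Proof.
move=> il; rewrite /choice_exp /= dfwith_in; congr oplus.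
by apply: eq_oplus_sum => j jl; rewrite dfwith_out //; apply: contraNneq il => ->.
Qed.

Lemma exp_prods_choices (I : eqType) (L : I -> seq Ord) (l : seq I) : uniq l ->
  exp_prods L l = map (choice_exp L l) (choices (fun i => size (L i)) l).
Proof.
elim: l => //= i l IH /andP [il /IH ->].
rewrite -{1}[L i](mkseq_nth ozero) /mkseq.
elim: (iota 0 _) => //= k ks IHk; rewrite map_cat -IHk -map_comp; congr cat.
by rewrite -map_comp; apply: eq_map => f; apply/esym/choice_exp_dfwith.
Qed.

(* The list of choices is lexicographic. A later choice of strictly larger exponent
   must use, in some coordinate, an earlier piece. *)
Lemma choices_order (I : eqType) (L : I -> seq Ord) (l : seq I) :
  (forall i, nonincr (L i)) -> uniq l ->
  List.ForallOrdPairs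
    (fun f g => (exists2 i, i \in l & f i < g i) /\
       (olt (choice_exp L l f) (choice_exp L l g) -> exists2 i, i \in l & g i < f i))
    (choices (fun i => size (L i)) l).
Proof.
move=> ni; elim: l => [|i l IH]; first by repeat constructor.
case/andP=> il /IH {}IH; set P := (fun f g : I -> nat => _ /\ _) in IH.
have up (k k' : nat) (f g : I -> nat) :
    (exists2 j, j \in l & f j < g j) -> exists2 j, j \in i :: l &
      dfwith f (k : (fun _ => nat) i) j < dfwith g (k' : (fun _ => nat) i) j.
  case=> j jl fg; exists j; first by rewrite inE jl orbT.
  by rewrite !dfwith_out //; apply: contraNneq il => ->.
have : forall k, List.In k (iota 0 (size (L i))) -> k < size (L i).
  by move=> k /In_mem; rewrite mem_iota.
rewrite /choices -/(choices _ l) /=.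
elim: (FOP_iota 0 (size (L i))) => [|k ks kks _ IHk] ksL /=; first by constructor.
apply: FOP_cat.
- apply: FOP_map; apply: FOP_impl IH => f g _ _ [fg gf]; split; first exact: up.
  rewrite !choice_exp_dfwith // => /olt_nge H; apply/up/gf/nole_lt => gf'.
  by apply: H; apply: ole_oplus (ole_refl _) gf'.
- by apply: IHk => k' k'ks; apply: ksL; right.
move=> _ h /List.in_map_iff [f [<- fl]] hks.
have [k' [g [k'ks gl ->]]] : exists k' g, [/\ List.In k' ks,
    List.In g (choices (fun i => size (L i)) l) & h = dfwith g (k' : (fun _ => nat) i)].
  elim: (ks) hks => //= k' ks' IHks /List.in_app_iff [/List.in_map_iff [g [<- gl]]|/IHks].
    by exists k', g; split=> //; left.
  by case=> k'' [g [kk gl ->]]; exists k'', g; split=> //; right.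
have kk' : k < k' by move/List.Forall_forall: kks; apply.
split; first by exists i; rewrite ?mem_head // !dfwith_in.
have k'L : k' < size (L i) by apply: ksL; right.
have aa := FOP_nth ozero ((nonincrP _).1 (ni i)) kk' k'L.
rewrite !choice_exp_dfwith // => /olt_nge H; apply: up.
have fg : olt (choice_exp L l f) (choice_exp L l g).
  by apply: nole_lt => gf; apply: H; apply: ole_oplus.
case: (List.ForallOrdPairs_In IH f g fl gl) => [E|[[_ /(_ fg)]|[H' _]]] //.
by case: (@olt_irrefl (choice_exp L l g)); rewrite -{1}E.
Qed.

(** Write [a] as omega plus a rest; the added one is absorbed by omega because [1 + n <= n + 1]. *)
Lemma oadd1_infinite a : ole oomega a -> oeq a (oadd oone a).
Proof.
case/osub_ex => r [ra ar]; split; first exact: ole_addl.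
apply: ole_trans (ole_oadd (ole_refl _) ar) _; apply: ole_trans (oaddA_le _ _ _) _.
apply: ole_trans ra; apply: ole_oadd (ole_refl _).
apply/ole_ltP => z /olt_oaddP [/olt_succ_le z0|[y [n yn] zy]].
  by exists 0.
exists n.+1; apply: ole_trans zy _; apply: ole_trans (ole_oadd (ole_refl _) yn) _.
elim: n {yn} => [|n IH]; first exact: oadd0r.
apply/ole_ltP => w /olt_oaddP [w1|[v /olt_succ_le vn wv]].
  by apply: olt_ole_trans w1 _; apply/ole_succ_lt/olt_succ_le/ole0x.
apply/olt_succ_le; apply: ole_trans wv _; apply: ole_trans IH.
exact: ole_oadd (ole_refl _) vn.
Qed.

Lemma In_nth T (x0 : T) s i : i < size s -> List.In (nth x0 s i) s.
Proof. by elim: s i => // x s IH [|i] /= H; [left|right; apply: IH]. Qed.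

Lemma Forall2_nth T U (P : T -> U -> Prop) x0 y0 s t i :
  List.Forall2 P s t -> i < size t -> P (nth x0 s i) (nth y0 t i).
Proof. by move=> H; elim: H i => {s t} [|x y s t Pxy _ IH] [|i] //=; apply: IH. Qed.

Lemma Forall2_size T U (P : T -> U -> Prop) s t : List.Forall2 P s t -> size s = size t.
Proof. by elim=> //= x y s' t' _ _ ->. Qed.

Lemma width_lower_bound (I : finType) (A : I -> Type)
    (le : forall i, A i -> A i -> Prop) (L : I -> seq Ord) (i0 j1 j2 : I) b :
  (forall i, transrel (le i)) ->
  (forall i, otype (le i) (fun _ => True) (cnf (L i))) ->
  (forall i, nonincr (L i)) -> L i0 = [:: b] -> ole oone b -> j1 != j2 ->
  (forall a, List.In a (L j1) \/ List.In a (L j2) -> ole oomega a) ->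
  rank_ge (incomp (all_le le)) (fun _ => True) (natsum (exp_prods L (enum I))).
Proof.
move=> tr Lo ni Li0 b1 j12 Linf.
have [Ds HD] : exists Ds : forall i, seq (A i -> Prop), forall i,
    List.Forall2 (fun D c => otype (le i) D (oexpw c)) (Ds i) (L i) /\
    List.ForallOrdPairs (sep (le i)) (Ds i).
  have H i : exists Ds : seq (A i -> Prop),
      List.Forall2 (fun D c => otype (le i) D (oexpw c)) Ds (L i) /\
      List.ForallOrdPairs (sep (le i)) Ds.
    have [Ds [H Dsep]] := separated_pieces (tr i) (ni i) (Lo i).2 (Lo i).1.
    by exists Ds; split=> //; apply: List.Forall2_impl H => D c [].
  pose c i := constructive_indefinite_description _ (H i).
  by exists (fun i => proj1_sig (c i)) => i; apply: proj2_sig (c i).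
pose S (f : I -> nat) i := nth (fun _ => False) (Ds i) (f i).
pose e := choice_exp L (enum I); pose K := choices (fun i => size (L i)) (enum I).
have KL f i : List.In f K -> f i < size (L i).
  by move=> fK; apply: choices_lt fK (mem_enum _ i).
have So f i : List.In f K -> otype (le i) (S f i) (oexpw (nth ozero (L i) (f i))).
  by move=> /KL fi; apply: Forall2_nth (HD i).1 (fi i).
have KO := choices_order ni (enum_uniq I).
pose P f g := exists i, sep (le i) (S f i) (S g i).
have Psep f g i : List.In f K -> List.In g K -> f i < g i -> P f g.
  move=> fK gK fg; exists i; apply: FOP_nth (HD i).2 fg _.
  by rewrite (Forall2_size (HD i).1); apply: KL.
(* Sorting by exponent makes the ordinary sum of box widths a normal form, hence equal to the
   natural sum, while keeping the boxes separated in order. *)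
have [|K' [KK' HK']] := @stable_sort _ e P K.
  apply: FOP_impl KO => f g fK gK [[i _ fg] H]; split; first exact: Psep fg.
  by move/H => [j _ gf]; apply: Psep gf.
have K'K f : List.In f K' -> List.In f K by apply: Permutation_in; apply: Permutation_sym.
pose qs := [seq (S f, oexpw (e f)) | f <- K'].
have niK : nonincr (map e K').
  by apply/nonincrP/FOP_map; apply: FOP_impl HK' => f g _ _ [].
have qsE : cnf (map e K') = osum (map snd qs) by rewrite /cnf -!map_comp.
apply: (@rank_ge_mono _ _ (fun x => exists2 q, List.In q qs & box q.1 x) _
  (osum (map snd qs))) => //.
  rewrite -qsE; apply: ole_trans (natsum_cnf niK).1; apply: natsum_perm.
  by rewrite exp_prods_choices ?enum_uniq //; apply: Permutation_map.
(* The indecomposable coordinate has a single piece, so all boxes share it and it can serve as the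
   restricted coordinate. *)
have fi0 f : List.In f K -> f i0 = 0.
  by move=> fK; have := KL f i0 fK; rewrite Li0 ltnS leqn0 => /eqP.
pose T := nth (fun _ => False) (Ds i0) 0.
have Tb : otype (le i0) T (oexpw b).
  by have := Forall2_nth (fun _ => False) ozero (HD i0).1 (i := 0); rewrite Li0; apply.
apply: (box_stack (i := i0) (T := T) (d := b)) => //.
  by apply: FOP_map; apply: FOP_impl HK' => f g _ _ [].
move=> _ /List.in_map_iff [f [<- /K'K fK]] /=.
split=> [x|T' T'b]; first by rewrite /S fi0.
(* The width found for a box has exponent one plus [e f], which is at least [e f]. *)
apply: (rank_ge_mono (S := box (dfwith (S f) T')) _ (ole_oexpw (ole_addl oone _))) => //.
apply: (box_width tr (enum_uniq I) j12) => i.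
set a := nth ozero (L i) (f i).
have aE : oeq a (exp1 j1 j2 i a).
  rewrite /exp1; case: ifP => [ij|_]; last exact: oeq_refl.
  apply: oadd1_infinite; apply: Linf.
  have aL : List.In a (L i) by apply/In_nth/KL.
  by case/orP: ij aL => /eqP ->; [left|right].
apply: (@otype_oeq _ _ _ (oexpw a)).
  by case: aE => H1 H2; split; apply: ole_oexpw.
have [ii|ii] := eqVneq i0 i; last by rewrite dfwith_out //; apply: So.
by move: @a aE; case: _ / ii => a aE; rewrite dfwith_in /a fi0 // Li0.
Qed.

Theorem mainTheorem15 (n : nat) (A : 'I_n -> Type)
  (le : forall i : 'I_n, A i -> A i -> Prop) (o : 'I_n -> Ord)
  (Hwqo : forall i, wqo (le i))
  (Ho : forall i, is_o (le i) (o i))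
  (Hind : exists i, inf_indecomposable (o i))
  (Hexp : exists j1 j2, j1 <> j2 /\ CNF_exponents_infinite (o j1) /\
                        CNF_exponents_infinite (o j2)) :
  exists c, nprods [seq o i | i <- enum 'I_n] c /\ is_w (prod_le le) c.
Proof.
have tr i : transrel (le i) by have [[_ H] _] := Hwqo i.
have [i0 [b [b1 ob]]] := Hind; have [j1 [j2 [/eqP j12 [[_ E1] [_ E2]]]]] := Hexp.
(* The normal form at [i0] is fixed to be the one-term list, giving a single piece there. *)
have [L HL] : exists L : 'I_n -> seq Ord,
    forall i, is_CNF (o i) (L i) /\ (i = i0 -> L i = [:: b]).
  have H i : exists l, is_CNF (o i) l /\ (i = i0 -> l = [:: b]).
    have [->|ii] := eqVneq i i0; last first.
      by have [l Hl] := cnf_ex (o i); exists l; split=> // /eqP; rewrite (negPf ii).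
    exists [:: b]; do 2!split=> //; apply: oeq_trans ob _.
    by split; [apply: ole_addr | apply: oadd0r].
  pose c i := constructive_indefinite_description _ (H i).
  by exists (fun i => proj1_sig (c i)) => i; apply: proj2_sig (c i).
have Lo i : otype (le i) (fun _ => True) (cnf (L i)).
  by apply: otype_oeq (HL i).1.2 _; apply/is_rank_chain; apply: Ho.
exists (natsum (exp_prods L (enum 'I_n))); split.
  by apply: nprods_natsum => i; apply: (HL i).1.
apply: (is_rank_chain (incomp (prod_le le)) _).2; split.
  apply: (width_lower_bound (i0 := i0) (j1 := j1) (j2 := j2) (b := b)) => //.
  - by move=> i; apply: (HL i).1.1.
  - exact: (HL i0).2.
  - by move=> a [/(E1 _ (HL j1).1)|/(E2 _ (HL j2).1)].
have C i : covered (nle (le i)) (fun _ => True) (L i) := cnf_covered (tr i) (Lo i).2.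
(* Antichain sequences are bad, so a bound on the maximal order type of the product bounds its
   width. *)
have := covered_natsum (covered_list_le (enum 'I_n) tr C).
apply: (rank_le_preim (f := id)) (ole_refl _) => // x y [nxy _] xy.
by apply: nxy => i; apply: xy; rewrite mem_enum.
Qed.
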